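(* Let $k\ge 0$ be an integer. Given any almost-embedding $\Delta_{2k+2}^{(k)}\to\mathbb{R}^{2k+1}$, there is no homotopy to its mirror image through almost-embeddings. The same is true for any almost-embedding $[3]^{*(k+1)}\to\mathbb{R}^{2k+1}$. That is, $$\mathrm{coind}(\mathrm{AEmb}_1(\Delta_{2k+2}^{(k)},\mathbb{R}^{2k+1})) = 0 \quad\text{and}\quad \mathrm{coind}(\mathrm{AEmb}_1([3]^{*(k+1)},\mathbb{R}^{2k+1})) = 0.$$
   Context: $\Delta_{2k+2}^{(k)}$ is the $k$-skeleton of the $(2k+2)$-dimensional simplex $\Delta_{2k+2}$ (which has $2k+3$ vertices). $[3]^{*(k+1)}$ is the $(k+1)$-fold join of the 0-dimensional simplicial complex consisting of three points: its vertex set is the disjoint union of $k+1$ three-element sets, and its faces are the sets of vertices containing at most one vertex from each of these sets. For a simplicial complex $\Sigma$, a continuous map $f$ from (the geometric realization of) $\Sigma$ to $\mathbb{R}^d$ is an almost-embedding if $f(\sigma)\cap f(\tau)=\emptyset$ for any two vertex-disjoint faces $\sigma,\tau$ of $\Sigma$. $\mathrm{AEmb}(\Sigma,\mathbb{R}^d)$ is the space of almost-embeddings with the compact-open topology. $\mathrm{AEmb}_1(\Sigma,\mathbb{R}^d)$ is this space with the $\mathbb{Z}/2$-action whose generator $\varepsilon$ acts by $(\varepsilon\cdot f)(x)=\varepsilon\cdot f(x)$, where $\varepsilon\cdot(x_1,x_2,\dots,x_d)=(-x_1,x_2,\dots,x_d)$. A mirror image of a map $f$ into $\mathbb{R}^d$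 is a map $h\circ f$ with $h\colon\mathbb{R}^d\to\mathbb{R}^d$ an orientation-reversing homeomorphism (for instance the reflection $\varepsilon$). A homotopy through almost-embeddings is a homotopy $f_t$, $t\in[0,1]$, with every $f_t$ an almost-embedding. The coindex $\mathrm{coind}(Y)$ of a $\mathbb{Z}/2$-space $Y$ is the largest integer $k$ such that there is a continuous $\mathbb{Z}/2$-equivariant map $S^k\to Y$, where $S^k$ carries the antipodal action; by convention $S^{-1}=\emptyset$, so $\mathrm{coind}(\emptyset)=-1$. *)

(* Defs.v *)
From HB Require Import structures.
From mathcomp Require Import all_boot all_order all_algebra.
From mathcomp Require Import boolp classical_sets functions set_interval.
From mathcomp Require Import reals topology normedtype.

Set Implicit Arguments.
Unset Strict Implicit.
Unset Printing Implicit Defensive.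

Import Order.TTheory GRing.Theory Num.Theory.
Import numFieldNormedType.Exports.

(** ** Finite simplicial complexes *)

(* The empty face is allowed; its geometric realization is empty. *)
Record simplicial_complex (V : finType) := SimplicialComplex {
  faces :> {set {set V}};
  faces_sub : forall s t : {set V}, t \subset s -> s \in faces -> t \in faces }.

Lemma simplex_sub n (s t : {set 'I_n.+1}) :
  t \subset s -> s \in [set: {set 'I_n.+1}] -> t \in [set: {set 'I_n.+1}].
Proof. by rewrite !inE. Qed.

Definition simplex (n : nat) : simplicial_complex 'I_n.+1 :=
  SimplicialComplex (@simplex_sub n).

Lemma skeleton_sub (V : finType) (K : simplicial_complex V) (k : nat)
    (s t : {set V}) : t \subset s ->
  s \in [set u in faces K | (#|u| <= k.+1)%N] ->
  t \in [set u in faces K | (#|u| <= k.+1)%N].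
Proof.
move=> ts; rewrite !inE => /andP[sK sk].
by rewrite (faces_sub ts sK) (leq_trans (subset_leq_card ts)).
Qed.

(* A face of dimension at most [k] has at most [k + 1] vertices. *)
Definition skeleton (V : finType) (k : nat) (K : simplicial_complex V) :
    simplicial_complex V :=
  SimplicialComplex (@skeleton_sub V K k).

Lemma points_sub m (s t : {set 'I_m}) : t \subset s ->
  s \in [set u : {set 'I_m} | (#|u| <= 1)%N] ->
  t \in [set u : {set 'I_m} | (#|u| <= 1)%N].
Proof. by move=> ts; rewrite !inE; exact/leq_trans/subset_leq_card. Qed.

(* The 0-dimensional complex [m] consisting of m points. *)
Definition points (m : nat) : simplicial_complex 'I_m :=
  SimplicialComplex (@points_sub m).

Lemma join_power_sub (V : finType) (K : simplicial_complex V) (n : nat)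
    (s t : {set 'I_n * V}) : t \subset s ->
  s \in [set u : {set 'I_n * V} |
          [forall i, [set v | (i, v) \in u] \in faces K]] ->
  t \in [set u : {set 'I_n * V} |
          [forall i, [set v | (i, v) \in u] \in faces K]].
Proof.
move=> ts; rewrite !inE => /forallP sK; apply/forallP => i.
apply: faces_sub (sK i); apply/fintype.subsetP => v; rewrite !inE.
exact: (fintype.subsetP ts).
Qed.

(* The n-fold join K * ... * K: the vertices are n disjoint copies of those of
   K, and a face is a union of one (possibly empty) face from each copy. *)
Definition join_power (V : finType) (K : simplicial_complex V) (n : nat) :
    simplicial_complex ('I_n * V)%type :=
  SimplicialComplex (@join_power_sub V K n).

Local Open Scope classical_set_scope.
Local Open Scope ring_scope.

(** ** Geometric realizations and almost-embeddings *)

Section AlmostEmbeddings.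
Variables (R : realType) (V : finType) (K : simplicial_complex V).

(* Barycentric coordinates; as K is finite, its topology is that of a subspace
   of R^V. *)
Definition realization_set : set {ptws V -> R} :=
  [set x | [/\ forall v, 0 <= x v, \sum_v x v = 1 &
              exists2 s, s \in faces K & forall v, v \notin s -> x v = 0]].

Definition realization : topologicalType := set_type realization_set.

Definition face_realization (s : {set V}) : set realization :=
  [set x | forall v, v \notin s -> (val x : V -> R) v = 0].

Definition almost_embedding (d : nat) (f : realization -> 'rV[R]_d) : Prop :=
  continuous f /\
  forall s t : {set V}, s \in faces K -> t \in faces K -> [disjoint s & t]%B ->
    f @` face_realization s `&` f @` face_realization t = set0.

Definition almost_embedding_homotopic (d : nat)
    (f g : realization -> 'rV[R]_d) : Prop :=
  exists H : R * realization -> 'rV[R]_d,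
    [/\ {within `[0, 1] `*` setT, continuous H},
        forall x, H (0, x) = f x,
        forall x, H (1, x) = g x &
        forall t : R, 0 <= t <= 1 -> almost_embedding (fun x => H (t, x))].

End AlmostEmbeddings.

(** ** Mirror images *)

Section Mirror.
Variables (R : realType) (d : nat).

Definition reflection (x : 'rV[R]_d) : 'rV[R]_d :=
  \row_j (if val j == 0%N then - x 0 j else x 0 j).

Definition homeomorphism (h : 'rV[R]_d -> 'rV[R]_d) : Prop :=
  continuous h /\
  exists g : 'rV[R]_d -> 'rV[R]_d, [/\ continuous g, cancel h g & cancel g h].

(* Homotopy of self-maps of R^d minus the origin. *)
Definition punctured_homotopic (f g : 'rV[R]_d -> 'rV[R]_d) : Prop :=
  exists H : R * 'rV[R]_d -> 'rV[R]_d,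
    [/\ {within `[0, 1] `*` [set x | x != 0], continuous H},
        forall x, x != 0 -> H (0, x) = f x,
        forall x, x != 0 -> H (1, x) = g x &
        forall (t : R) x, 0 <= t <= 1 -> x != 0 -> H (t, x) != 0].

(* h has local degree -1 (at the origin, hence everywhere).  For d > 0, R^d
   minus the origin is homotopy equivalent to the sphere S^(d-1), whose
   self-homotopy-equivalences are determined up to homotopy by their degree,
   which is 1 or -1; a linear reflection has degree -1. *)
Definition orientation_reversing (h : 'rV[R]_d -> 'rV[R]_d) : Prop :=
  punctured_homotopic (fun x => h x - h 0) reflection.

Definition mirror_image (T : Type) (f g : T -> 'rV[R]_d) : Prop :=
  exists h : 'rV[R]_d -> 'rV[R]_d,
    [/\ homeomorphism h, orientation_reversing h & g = h \o f].

Lemma reflectionK : involutive reflection.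
Proof.
by move=> x; apply/rowP => j; rewrite !mxE; case: (_ == _); rewrite ?opprK.
Qed.

Lemma reflection_continuous : continuous reflection.
Proof.
move=> x A -[B Bnbhs BA].
exists (fun i j => if val j == 0%N then -%R @^-1` B i j else B i j).
  move=> i j; have := Bnbhs i j; rewrite ord1 mxE; case: ifP => // _.
  by move=> xB; exact: (@opp_continuous R^o _ _ xB).
move=> y yB; apply: BA => i j; have := yB i j; rewrite !mxE !ord1.
by case: ifP.
Qed.

End Mirror.

(** ** Z/2-spaces and the coindex *)

Record Z2space := Z2Space {
  Z2_sort :> topologicalType;
  Z2_gen : Z2_sort -> Z2_sort;
  Z2_gen_continuous : continuous Z2_gen;
  Z2_genK : involutive Z2_gen }.

Definition equivariant_map (X Y : Z2space) (f : X -> Y) : Prop :=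
  continuous f /\ forall x, f (Z2_gen x) = Z2_gen (f x).

Lemma set_type_map_continuous (T : topologicalType) (A : set T)
    (a : T -> T) (b : A -> A) :
  continuous a -> (forall x, val (b x) = a (val x)) -> continuous b.
Proof.
move=> ac bE; apply/continuousP => _ [U oU <-].
exists (a @^-1` U); first exact: open_comp.
by apply/seteqP; split=> x /=; rewrite !set_valE /= bE.
Qed.

Section Sphere.
Variables (R : realType) (n : nat).

(* The unit sphere of R^n, that is S^(n-1); it is empty for n = 0. *)
Definition sphere_set : set 'rV[R]_n := [set x | \sum_j x 0 j ^+ 2 = 1].

Lemma antipode_subproof (x : sphere_set) : - val x \in sphere_set.
Proof.
case: x => x /=; rewrite !inE /sphere_set /= => <-.
by apply: eq_bigr => j _; rewrite mxE sqrrN.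
Qed.

Definition antipode (x : sphere_set) : sphere_set :=
  exist _ (- val x) (antipode_subproof x).

Lemma antipode_continuous : continuous antipode.
Proof.
apply: (@set_type_map_continuous 'rV[R]_n sphere_set -%R) => //.
move=> x A -[B Bnbhs BA].
exists (fun i j => -%R @^-1` B i j).
  move=> i j; have := Bnbhs i j; rewrite mxE.
  by move=> xB; exact: (@opp_continuous R^o _ _ xB).
by move=> y yB; apply: BA => i j; have := yB i j; rewrite !mxE.
Qed.

Lemma antipodeK : involutive antipode.
Proof. by move=> x; apply: val_inj; rewrite /= opprK. Qed.

Definition sphere : Z2space := Z2Space antipode_continuous antipodeK.

End Sphere.

(* There is an equivariant map S^j -> Y. *)
Definition sphere_maps_to (R : realType) (Y : Z2space) (j : int) : Prop :=
  exists n : nat, j = n%:Z - 1 /\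
    exists f : sphere R n -> Y, equivariant_map f.

(* coind(Y) = c *)
Definition is_coindex (R : realType) (Y : Z2space) (c : int) : Prop :=
  sphere_maps_to R Y c /\ forall j : int, sphere_maps_to R Y j -> j <= c.

Section AEmb.
Variables (R : realType) (V : finType) (K : simplicial_complex V) (d : nat).

Definition AEmb_set : set {compact-open, realization R K -> 'rV[R]_d} :=
  [set f | almost_embedding f].

Lemma AEmb_reflect_subproof (f : AEmb_set) :
  (@reflection R d \o val f : {compact-open, realization R K -> 'rV[R]_d})
    \in AEmb_set.
Proof.
case: f => f /=; rewrite !inE => -[fc fd]; split.
  by move=> x; apply: continuous_comp; [exact: fc|exact: reflection_continuous].
move=> s t sK tK st; rewrite -subset0 => y [[x xs <-] [z zt]] /=.
move=> /(inv_inj (@reflectionK R d)) zx.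
have : (f @` face_realization s `&` f @` face_realization t) (f x).
  by split; [exists x|exists z].
by rewrite (fd s t sK tK st).
Qed.

Definition AEmb_reflect (f : AEmb_set) : AEmb_set :=
  exist (fun g => g \in AEmb_set) _ (AEmb_reflect_subproof f).

Lemma AEmb_reflect_continuous : continuous AEmb_reflect.
Proof.
apply: (@set_type_map_continuous
  {compact-open, realization R K -> 'rV[R]_d} AEmb_set
  (fun f : {compact-open, realization R K -> 'rV[R]_d} =>
     (@reflection R d \o f : {compact-open, realization R K -> 'rV[R]_d}))) => //.
move=> f; apply/compact_open_cvgP.
  exact/fmap_filter/nbhs_filter.
move=> A O cA oO fAO.
have oO' : open (@reflection R d @^-1` O).
  by apply: open_comp => // x _; exact: reflection_continuous.
have : nbhs (f : {compact-open, realization R K -> 'rV[R]_d})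
    [set g | g @` A `<=` @reflection R d @^-1` O].
  apply: open_nbhs_nbhs; split; first exact: compact_open_open.
  by move=> _ [x Ax <-]; apply: fAO; exists x.
apply: filterS => g gA _ [x Ax <-].
by apply: gA; exists x.
Qed.

Lemma AEmb_reflectK : involutive AEmb_reflect.
Proof.
move=> f; apply: val_inj; apply/funext => x /=; exact: reflectionK.
Qed.

Definition AEmb1 : Z2space := Z2Space AEmb_reflect_continuous AEmb_reflectK.

End AEmb.

(* Main.v *)
(** The deleted join of each of the two complexes is a sphere: a vector of
    R^(2k+2) is extended by zeros to the vertices, the median of each block of
    vertices is subtracted (one block of 2k+3 vertices, or k+1 blocks of 3
    vertices), and the positive and negative parts of the result, say of masses
    P and Q, are supported on two disjoint faces.  After normalization they are
    points x and y of the realization, and an almost-embedding f yields the odd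
    map w |-> (P - Q, c (f x - f y)) of R^(2k+2) minus the origin, where the
    cutoff c is positive if P = Q and vanishes near P Q = 0.  An odd map has odd
    degree, and a homotopy through almost-embeddings preserves the degree.  If h
    is a homeomorphism, then h (f x) - h (f y) is homotopic to
    h (f x - f y) - h 0 through h (f x - t f y) - h (f y - t f y), so that an
    orientation-reversing h changes the sign of the degree.  Hence a homotopy
    from f to h o f would force the odd degree to be 0.

    The degree is combinatorial.  A vector is labelled by the index and the sign
    of a coordinate of largest absolute value, and the degree counts, with
    signs, the simplices of a fine barycentric subdivision of the boundary of
    the cross-polytope that carry the labels +0, -1, +2, ...  Chains are never
    written down: subdivision and the fundamental cycle are defined by their
    transposes, acting on functions of tuples of points.  That the degree of an
    odd map is odd is Fan's lemma. *)

Require Import Defs.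
From mathcomp Require Import all_boot all_order all_algebra all_fingroup.
From mathcomp Require Import ring lra zify.
From mathcomp Require Import boolp classical_sets functions cardinality.
From mathcomp Require Import set_interval reals topology normedtype sequences.
From mathcomp Require Import realfun.

Set Implicit Arguments.
Unset Strict Implicit.
Unset Printing Implicit Defensive.

Import Order.TTheory GRing.Theory Num.Theory.
Import numFieldNormedType.Exports.
Local Open Scope classical_set_scope.
Local Open Scope ring_scope.

(** * Cochains on tuples of points *)

Section Coboundary.
Variables (A : comNzRingType) (T : Type).
Implicit Types (phi psi : seq T -> A) (s : seq T).

(** The recursion deletes the head or, with the opposite sign, an entry of the tail; [coboundaryE]
    is the closed form. *)
Fixpoint coboundary phi s : A :=
  if s is x :: s' then phi s' - coboundary (phi \o cons x) s' else 0.

Lemma eq_coboundary phi psi s :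
    (forall u, (size u).+1 = size s -> phi u = psi u) ->
  coboundary phi s = coboundary psi s.
Proof.
elim: s phi psi => [//|x s IH] phi psi e /=.
by rewrite e // (IH _ (psi \o cons x)) // => u /= us; rewrite e //= us.
Qed.

Lemma coboundaryD phi psi s :
  coboundary (fun u => phi u + psi u) s = coboundary phi s + coboundary psi s.
Proof.
elim: s phi psi => [|x s IH] phi psi /=; first by rewrite addr0.
by rewrite (IH (phi \o cons x) (psi \o cons x)); ring.
Qed.

Lemma coboundaryN phi s :
  coboundary (fun u => - phi u) s = - coboundary phi s.
Proof.
elim: s phi => [|x s IH] phi /=; first by rewrite oppr0.
by rewrite (IH (phi \o cons x)); ring.
Qed.

Lemma coboundaryB phi psi s :
  coboundary (fun u => phi u - psi u) s = coboundary phi s - coboundary psi s.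
Proof. by rewrite coboundaryD coboundaryN. Qed.

Lemma coboundaryK phi s : coboundary (coboundary phi) s = 0.
Proof.
elim: s phi => [//|x s IH] phi.
by rewrite /= (coboundaryB phi (coboundary (phi \o cons x))) IH subr0 subrr.
Qed.

Lemma coboundaryE (phi : seq T -> A) s :
  coboundary phi s =
    \sum_(i < size s) (-1) ^+ i * phi (take i s ++ drop i.+1 s).
Proof.
elim: s phi => [|x s IH] phi /=; first by rewrite big_ord0.
rewrite big_ord_recl expr0 mul1r /= drop0 IH -sumrN; congr (_ + _).
by apply: eq_bigr => i _; rewrite exprS mulN1r mulNr.
Qed.

End Coboundary.

Lemma eq_in_coboundary (A : comNzRingType) (T : eqType)
    (phi psi : seq T -> A) s :
  (forall u, (size u).+1 = size s -> subseq u s -> phi u = psi u) ->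
  coboundary phi s = coboundary psi s.
Proof.
elim: s phi psi => [//|x s IH] phi psi e /=.
rewrite e ?subseq_cons // (IH _ (psi \o cons x)) // => u us usub /=.
by apply: e => /=; rewrite ?us ?eqxx.
Qed.

Lemma coboundary_map (A : comNzRingType) (T U : Type) (f : T -> U)
    (phi : seq U -> A) s :
  coboundary (phi \o map f) s = coboundary phi (map f s).
Proof.
elim: s phi => [//|x s IH] phi /=.
by rewrite -(IH (phi \o cons (f x))).
Qed.

Lemma coboundary_rmorph (A B : comNzRingType) (h : {rmorphism A -> B})
    (T : Type)
    (phi : seq T -> A) s :
  coboundary (h \o phi) s = h (coboundary phi s).
Proof.
elim: s phi => [|x s IH] phi /=; first by rewrite rmorph0.
by rewrite (IH (phi \o cons x)) rmorphB.
Qed.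

Section Prism.
Variables (A : comNzRingType) (T U : Type) (a b : T -> U).
Implicit Types (phi psi : seq U -> A).

(* The dual of the prism operator: the sum over [i] of [(-1)^i] times the value
   of the cochain at [a x_0, ..., a x_i, b x_i, ..., b x_m]. *)
Fixpoint prism phi (s : seq T) : A :=
  if s is x :: s' then
    phi [:: a x, b x & map b s'] - prism (phi \o cons (a x)) s'
  else 0.

Lemma prismB phi psi s :
  prism (fun u => phi u - psi u) s = prism phi s - prism psi s.
Proof.
elim: s phi psi => [|x s IH] phi psi /=; first by rewrite subr0.
by rewrite (IH (phi \o cons (a x)) (psi \o cons (a x))); ring.
Qed.

(** The dual of the chain homotopy between the maps induced by [a] and [b]. It is the source of the
    homotopy invariance of the degree. *)
Lemma prism_coboundary phi s :
  prism (coboundary phi) s =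
    phi (map b s) - phi (map a s) - coboundary (prism phi) s.
Proof.
elim: s phi => [|x s IH] phi /=; first by rewrite !subrr.
have -> : prism (coboundary phi \o cons (a x)) s =
    prism phi s - prism (coboundary (phi \o cons (a x))) s.
  by rewrite -prismB.
rewrite IH /=.
have -> : coboundary (prism phi \o cons x) s =
    coboundary ((phi \o cons (a x) \o cons (b x)) \o map b) s -
    coboundary (prism (phi \o cons (a x))) s.
  by rewrite -coboundaryB.
rewrite coboundary_map; ring.
Qed.

End Prism.

Lemma prism_eq0 (A : comNzRingType) (T U : eqType) (a b : T -> U)
    (P : U -> Prop)
    (phi : seq U -> A) s :
  {in s, forall x, P (a x) /\ P (b x)} ->
  (forall u, size u = (size s).+1 -> {in u, forall y, P y} -> phi u = 0) ->
  prism a b phi s = 0.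
Proof.
elim: s phi => [//|x s IH] phi Ps phi0 /=.
have [Pa Pb] := Ps x (mem_head x s).
rewrite phi0 /= ?size_map //; last first.
  move=> y; rewrite !inE => /or3P[/eqP->//|/eqP->//|/mapP[z zs ->]].
  by have [] := Ps z; rewrite ?inE ?zs ?orbT.
rewrite IH ?subrr // => [y ys|u us uP]; first by apply: Ps; rewrite inE ys orbT.
by apply: phi0 => /= [|y]; rewrite ?us // inE => /predU1P[->//|/uP].
Qed.

Lemma coboundaryMl (A : comNzRingType) (T : Type) (c : A) (phi : seq T -> A) s :
  coboundary (fun u => c * phi u) s = c * coboundary phi s.
Proof.
elim: s phi => [|x s IH] phi /=; first by rewrite mulr0.
by rewrite (IH (phi \o cons x)) mulrBr.
Qed.

(** * Barycentric subdivision *)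

Definition barycenter (F : fieldType) (W : lmodType F) (s : seq W) : W :=
  (size s)%:R^-1 *: \sum_(x <- s) x.

Lemma barycenter_opp (F : fieldType) (W : lmodType F) (s : seq W) :
  barycenter (map -%R s) = - barycenter s.
Proof. by rewrite /barycenter size_map big_map sumrN scalerN. Qed.

Section Subdivision.
Variables (A : comNzRingType) (F : fieldType) (W : lmodType F).
Implicit Types (phi psi : seq W -> A) (s : seq W).

(** The counter [m], meant to be [size s], makes the recursion structural: the faces at which
    [coboundary] evaluates are not subterms of [s]. *)
Fixpoint subdivision_rec m phi s : A :=
  if m is m'.+1 then
    coboundary (subdivision_rec m' (phi \o cons (barycenter s))) s
  else phi s.

(* The dual of barycentric subdivision, which replaces a simplex by the cone
   from its barycenter over the subdivision of its boundary. *)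
Definition subdivision phi s := subdivision_rec (size s) phi s.

Lemma subdivision_recB m phi psi s :
  subdivision_rec m (fun u => phi u - psi u) s =
  subdivision_rec m phi s - subdivision_rec m psi s.
Proof.
elim: m phi psi s => [//|m IH] phi psi s /=.
rewrite -coboundaryB; apply: eq_coboundary => u _.
exact: (IH (phi \o cons _) (psi \o cons _)).
Qed.

Lemma subdivision_recD m phi psi s :
  subdivision_rec m (fun u => phi u + psi u) s =
  subdivision_rec m phi s + subdivision_rec m psi s.
Proof.
elim: m phi psi s => [//|m IH] phi psi s /=.
rewrite -coboundaryD; apply: eq_coboundary => u _.
exact: (IH (phi \o cons _) (psi \o cons _)).
Qed.

Lemma subdivisionD phi psi s :
  subdivision (fun u => phi u + psi u) s =
    subdivision phi s + subdivision psi s.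
Proof. exact: subdivision_recD. Qed.

(** Subdivision is a chain map, because the boundary of a cone is its base minus the cone over the
    boundary of the base. *)
Lemma subdivision_rec_coboundary m phi s : size s = m.+1 ->
  subdivision_rec m.+1 (coboundary phi) s =
    coboundary (subdivision_rec m phi) s.
Proof.
elim: m phi s => [|m IH] phi s sm.
  by case: s sm => [//|x [|]//] _ /=; rewrite !subr0.
set b := barycenter s.
transitivity (coboundary (fun u => subdivision_rec m.+1 phi u -
    subdivision_rec m.+1 (coboundary (phi \o cons b)) u) s).
  by apply: eq_coboundary => u us; rewrite -subdivision_recB.
(* By induction the second term is a coboundary of a coboundary. *)
rewrite coboundaryB [X in _ - X](_ : _ = 0) ?subr0 //.
rewrite -[RHS](coboundaryK (subdivision_rec m (phi \o cons b)) s).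
apply: eq_coboundary => u us; apply: IH; move: us; rewrite sm => -[].
by [].
Qed.

Lemma subdivision_coboundary phi s :
  subdivision (coboundary phi) s = coboundary (subdivision phi) s.
Proof.
case: s => [//|x s]; rewrite /subdivision subdivision_rec_coboundary //.
by apply: eq_coboundary => u /= [->].
Qed.

Lemma subdivision_opp phi s :
  subdivision (phi \o map -%R) s = subdivision phi (map -%R s).
Proof.
rewrite /subdivision size_map; move: (size s) => m;
  elim: m phi s => [//|m IH] phi s /=.
rewrite -coboundary_map; apply: eq_coboundary => u _.
rewrite -[RHS]/(subdivision_rec _ _ (map _ u)) -IH barycenter_opp.
by congr subdivision_rec.
Qed.

End Subdivision.

Lemma subdivision_rmorph (A B : comNzRingType) (h : {rmorphism A -> B})
    (F : fieldType) (W : lmodType F) (phi : seq W -> A) s :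
  subdivision (h \o phi) s = h (subdivision phi s).
Proof.
rewrite /subdivision; move: (size s) => m; elim: m phi s => [//|m IH] phi s /=.
rewrite -coboundary_rmorph; apply: eq_coboundary => u _.
by rewrite -[RHS]/(h _) -IH.
Qed.

(** A weak form of convexity, enough to contain all the vertices of the subdivisions of a simplex
    with vertices in [C]. *)
Definition barycenter_closed (F : fieldType) (W : lmodType F) (C : W -> Prop) :=
  forall s, s != [::] -> {in s, forall x, C x} -> C (barycenter s).

Definition diameter_le (R : realType) (W : normedModType R) (e : R)
    (s : seq W) :=
  {in s &, forall x y, `|x - y| <= e}.

Section Mesh.
Variables (R : realType) (W : normedModType R).
Implicit Types (C : W -> Prop) (s u : seq W) (e : R).

Lemma sub_barycenter s c : s != [::] ->
  c - barycenter s = (size s)%:R^-1 *: \sum_(x <- s) (c - x).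
Proof.
move=> s0; rewrite sumrB big_const_seq count_predT iter_addr_0 scalerBr.
by rewrite -[c *+ _]scaler_nat scalerA mulVf ?scale1r // pnatr_eq0 size_eq0.
Qed.

Lemma ball_barycenter_closed c e :
  barycenter_closed (fun x : W => `|c - x| <= e).
Proof.
move=> s s0 sc; rewrite /= sub_barycenter // normrZ.
have s1 : 0 < (size s)%:R :> R by rewrite ltr0n lt0n size_eq0.
rewrite ger0_norm ?invr_ge0 ?ler0n // ler_pdivrMl //.
apply: (le_trans (ler_norm_sum _ _ _)).
rewrite mulr_natl -[leRHS](_ : \sum_(x <- s) e = _); last first.
  by rewrite big_const_seq count_predT iter_addr_0.
by rewrite big_seq [leRHS]big_seq; apply: ler_sum => x /sc.
Qed.

(** Among the [size s] differences that are averaged, the one for [v] itself vanishes. *)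
Lemma dist_barycenter s e v : v \in s -> diameter_le e s ->
  `|barycenter s - v| <= (1 - (size s)%:R^-1) * e.
Proof.
move=> vs ds.
have s0 : s != [::] by case: (s) vs.
have s1 : 0 < (size s)%:R :> R by rewrite ltr0n lt0n size_eq0.
rewrite distrC sub_barycenter // normrZ ger0_norm ?invr_ge0 ?ler0n //.
rewrite (perm_big _ (perm_to_rem vs)) big_cons subrr /= add0r.
rewrite ler_pdivrMl // mulrA mulrBr divff ?gt_eqF // mulr1.
apply: (le_trans (ler_norm_sum _ _ _)).
apply: (@le_trans _ _ (\sum_(x <- rem v s) e)).
  rewrite big_seq [leRHS]big_seq; apply: ler_sum => x /mem_rem xs.
  exact: ds.
rewrite big_const_seq count_predT iter_addr_0 size_rem // -[e *+ _]mulr_natl.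
by rewrite -subn1 natrB // lt0n size_eq0.
Qed.

Variables (A : comNzRingType) (n : nat).
Implicit Types (phi psi : seq W -> A).

Definition mesh_ratio : R := 1 - n%:R^-1.

(** The dual statement that subdivision shrinks simplices: its simplices are never listed, but the
    value of the subdivided cochain at [s] depends only on the values of the cochain at small tuples
    in [C]. *)
Lemma eq_subdivision C e phi psi s : 0 <= e -> (size s <= n)%N ->
  barycenter_closed C -> {in s, forall x, C x} -> diameter_le e s ->
  (forall u, size u = size s -> {in u, forall x, C x} ->
     diameter_le (mesh_ratio * e) u -> phi u = psi u) ->
  subdivision phi s = subdivision psi s.
Proof.
rewrite /subdivision => e0.
suff H m : size s = m -> (size s <= n)%N ->
    barycenter_closed C -> {in s, forall x, C x} -> diameter_le e s ->
    (forall u, size u = size s -> {in u, forall x, C x} ->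
       diameter_le (mesh_ratio * e) u -> phi u = psi u) ->
    subdivision_rec m phi s = subdivision_rec m psi s by exact: H.
elim: m C phi psi s => [|m IH] C phi psi s sm sn Ccl sC ds phipsi.
  by rewrite (size0nil sm) /=; apply: phipsi; rewrite // (size0nil sm).
rewrite /=; apply: eq_in_coboundary => u; rewrite sm => -[um] /mem_subseq us.
have s0 : s != [::] by rewrite -size_eq0 sm.
(* The faces of [s] are subdivided inside a ball around the barycenter of [s], so that this
   barycenter can be prepended without exceeding the diameter bound. *)
pose C' x := C x /\ `|barycenter s - x| <= mesh_ratio * e.
apply: (IH C') => //.
- by rewrite um (leq_trans _ sn) // sm.
- move=> v v0 vC; split; first by apply: Ccl => // x /vC[].
  by apply: ball_barycenter_closed => // x /vC[].
- move=> x /us xs; split; first exact: sC.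
  apply: (le_trans (dist_barycenter xs ds)); apply: ler_wpM2r => //.
  by rewrite lerB // lef_pV2 ?posrE ?ltr0n ?ler_nat // ?sm //
    (leq_trans _ sn) ?sm.
- by move=> x y /us xs /us ys; apply: ds.
move=> v vm vC dv; apply: phipsi => [|x|x y] /=; first by rewrite vm um sm.
  by rewrite inE => /predU1P[->|/vC[]//]; apply: Ccl.
rewrite !inE => /predU1P[->|xv] /predU1P[->|yv].
- by rewrite subrr normr0 mulr_ge0 // subr_ge0 invf_le1 ?ler1n ?ltr0n
    // (leq_trans _ sn) ?sm.
- by have [] := vC y yv.
- by rewrite distrC; have [] := vC x xv.
- exact: dv.
Qed.

Lemma eq_iter_subdivision N C e phi psi s : 0 <= e -> (size s <= n)%N ->
  barycenter_closed C -> {in s, forall x, C x} -> diameter_le e s ->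
  (forall u, size u = size s -> {in u, forall x, C x} ->
     diameter_le (mesh_ratio ^+ N * e) u -> phi u = psi u) ->
  iter N (@subdivision A R W) phi s = iter N (@subdivision A R W) psi s.
Proof.
move=> e0 sn Ccl; have [s0|s0] := posnP (size s).
  move=> _ _ phipsi; have -> : iter N (@subdivision A R W) phi s = phi s.
    by rewrite (size0nil s0); elim: (N).
  have -> : iter N (@subdivision A R W) psi s = psi s.
    by rewrite (size0nil s0); elim: (N).
  by apply: phipsi; rewrite (size0nil s0).
have r0 : 0 <= mesh_ratio.
  by rewrite subr_ge0 invf_le1 ?ler1n ?ltr0n ?(leq_trans s0).
elim: N e s e0 sn s0 => [|N IH] e s e0 sn s0 sC ds phipsi.
  by apply: phipsi => //; rewrite expr0 mul1r.
rewrite !iterS; apply: (eq_subdivision (C := C) e0) => // u us uC du.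
apply: (IH (mesh_ratio * e)) => //; rewrite ?us ?mulr_ge0 // => v vu vC dv.
by apply: phipsi => //; rewrite exprSr -mulrA.
Qed.

End Mesh.

(** * The fundamental cycle of the cross-polytope *)

Section CrossPolytope.
Variables (A : comNzRingType) (W : zmodType) (axis : nat -> W).
Implicit Types (phi psi : seq W -> A) (b : nat -> bool).

(* Evaluation on the fundamental cycle of the boundary of the cross-polytope
   with vertices [axis i] and [- axis i] for [i < m].  The cycle is built
   hemisphere by hemisphere: it is the cone [e] from [axis i] over the equator,
   plus or minus the antipode of [e]. *)
Fixpoint cross_cycle m phi : A :=
  if m is i.+1 then
    cross_cycle i (phi \o cons (axis i)) +
    (-1) ^+ i.+1 * cross_cycle i ((phi \o map -%R) \o cons (axis i))
  else phi [::].

Fixpoint cross_facet b m : seq W :=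
  if m is i.+1 then (if b i then - axis i else axis i) :: cross_facet b i
  else [::].

Lemma size_cross_facet b m : size (cross_facet b m) = m.
Proof. by elim: m => //= m ->. Qed.

Lemma eq_cross_facet b b' m : (forall i, (i < m)%N -> b i = b' i) ->
  cross_facet b m = cross_facet b' m.
Proof.
by elim: m => //= m IH e; rewrite e // IH // => i im; apply: e; apply: leqW.
Qed.

Lemma cross_facetN b m :
  map -%R (cross_facet b m) = cross_facet (fun i => ~~ b i) m.
Proof. by elim: m => //= m ->; case: (b m); rewrite ?opprK. Qed.

Lemma cross_facet_cons b c m : exists b',
  (if c then - axis m else axis m) :: cross_facet b m = cross_facet b' m.+1.
Proof.
exists (fun i => if i == m then c else b i); rewrite /= eqxx; congr (_ :: _).
by apply: eq_cross_facet => i im; rewrite ltn_eqF.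
Qed.

(** The cycle is supported on the facets; two cochains are always compared on it through this
    lemma. *)
Lemma eq_cross_cycle m phi psi :
  (forall b, phi (cross_facet b m) = psi (cross_facet b m)) ->
  cross_cycle m phi = cross_cycle m psi.
Proof.
elim: m phi psi => [|m IH] phi psi e /=; first exact: (e xpred0).
congr (_ + _ * _); apply: IH => b /=.
  by have [b' /= ->] := cross_facet_cons b false m; exact: e.
rewrite cross_facetN.
by have [b' /= ->] := cross_facet_cons (fun i => ~~ b i) true m; exact: e.
Qed.

Lemma cross_cycleD m phi psi :
  cross_cycle m (fun u => phi u + psi u) =
    cross_cycle m phi + cross_cycle m psi.
Proof.
elim: m phi psi => [//|m IH] phi psi /=.
rewrite (IH (phi \o cons _) (psi \o cons _)).
rewrite (IH (phi \o map -%R \o cons _) (psi \o map -%R \o cons _)); ring.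
Qed.

Lemma cross_cycleN m phi : cross_cycle m (fun u => - phi u) =
    - cross_cycle m phi.
Proof.
elim: m phi => [//|m IH] phi /=.
rewrite (IH (phi \o cons _)) (IH (phi \o map -%R \o cons _)); ring.
Qed.

Lemma cross_cycleB m phi psi :
  cross_cycle m (fun u => phi u - psi u) =
    cross_cycle m phi - cross_cycle m psi.
Proof. by rewrite cross_cycleD cross_cycleN. Qed.

(** The antipodal map of the sphere of dimension [m - 1] has degree [(-1) ^+ m]. *)
Lemma cross_cycle_opp m phi :
  cross_cycle m (phi \o map -%R) = (-1) ^+ m * cross_cycle m phi.
Proof.
case: m => [|m] /=; first by rewrite mul1r.
rewrite mulrDr mulrA -exprD addnn -mul2n exprM sqrrN !expr1n mul1r addrC.
congr (_ * _ + _); apply: eq_cross_cycle => b /=.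
by rewrite opprK -map_comp (eq_map (@opprK _)) map_id.
Qed.

(** Each hemisphere is bounded by the equator. The antipodal map multiplies the equatorial cycle by
    [(-1) ^+ m], so with the sign [(-1) ^+ m.+1] of the second hemisphere the two boundaries
    cancel. *)
Lemma cross_cycle_coboundary m phi : cross_cycle m (coboundary phi) = 0.
Proof.
elim: m phi => [//|m IH] phi.
have cone psi : cross_cycle m (coboundary psi \o cons (axis m)) =
  cross_cycle m psi.
  rewrite -[RHS]subr0 -(IH (psi \o cons (axis m))) -cross_cycleB.
  exact: eq_cross_cycle.
rewrite /= cone -[X in _ + _ * X](_ : cross_cycle m
    (coboundary (phi \o map -%R) \o cons (axis m)) = _); last first.
  by apply: eq_cross_cycle => b; rewrite /= -coboundary_map.
rewrite cone cross_cycle_opp mulrA -exprD addSn addnn -mul2n exprS exprM.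
by rewrite sqrrN !expr1n !mulN1r subrr.
Qed.

(* The cochain analogue of the Borsuk-Ulam theorem. *)
Lemma cross_cycle_odd m phi : (2%:R = 0 :> A) -> phi [::] = 1 ->
  (forall i b, (i < m)%N -> let s := cross_facet b i.+1 in
     coboundary phi s = phi s + phi (map -%R s)) ->
  cross_cycle m phi = 1.
Proof.
move=> A2 phi0; elim: m => [//|m IH] dphi.
have N1 : -1 = 1 :> A by apply/eqP; rewrite eq_sym -subr_eq0 opprK -mulr2n A2.
rewrite /= N1 expr1n mul1r -cross_cycleD.
(* At [s = axis m :: u] the hypothesis replaces [phi s + phi (map -%R s)] by [phi u - coboundary
   (phi \o cons (axis m)) u]. The last term is killed by the equatorial cycle, and the first one is
   the induction hypothesis. *)
rewrite -[RHS]IH => [|i b im]; last by apply: dphi; rewrite ltnW.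
rewrite -[RHS]subr0 -(cross_cycle_coboundary m (phi \o cons (axis m)))
  -cross_cycleB.
apply: eq_cross_cycle => b.
have [b' b'E] := cross_facet_cons b false m.
by move: (dphi m b' (ltnSn m)); cbv zeta; rewrite -b'E /= => <-.
Qed.

End CrossPolytope.

Lemma cross_cycle_rmorph (A B : comNzRingType) (h : {rmorphism A -> B})
    (W : zmodType) (axis : nat -> W) m (phi : seq W -> A) :
  cross_cycle axis m (h \o phi) = h (cross_cycle axis m phi).
Proof.
elim: m phi => [//|m IH] phi.
by rewrite /= rmorphD rmorphM rmorphXn rmorphN1 -!IH.
Qed.

(** * Labels and the lemma of Fan *)

(* The label [(j, b)] stands for the vertex [+e_j] of the cross-polytope if [b]
   is [false], and for [-e_j] if [b] is [true]. *)
Definition label := (nat * bool)%type.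

Definition label_opp (x : label) : label := (x.1, ~~ x.2).

Definition label_flip (j : nat) (x : label) : label :=
  if x.1 == j then label_opp x else x.

Definition complement_free (u : seq label) : bool :=
  all (fun x => label_opp x \notin u) u.

Definition label_le (x y : label) : bool :=
  (x.1 < y.1)%N || ((x.1 == y.1) && (x.2 ==> y.2)).

Lemma label_le_total : total label_le.
Proof. by move=> [i a] [j b]; rewrite /label_le /=; case: a b => -[]; lia. Qed.

Lemma label_le_trans : transitive label_le.
Proof.
by move=> [i a] [j b] [k c]; rewrite /label_le /=; case: a b c => -[] []; lia.
Qed.

Lemma label_le_anti : antisymmetric label_le.
Proof.
move=> [i a] [j b] H.
have [-> ->] : i = j /\ a = b.
  by move: H; rewrite /label_le /=; case: a b => -[] H; split=> //; lia.
by [].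
Qed.

Lemma complement_free_perm u v : perm_eq u v ->
  complement_free u = complement_free v.
Proof.
move=> uv; rewrite /complement_free (perm_all _ uv).
by apply: eq_all => x; rewrite (perm_mem uv).
Qed.

Lemma complement_freeP u : reflect
  {in u &, forall x y, x.1 = y.1 -> x = y} (complement_free u).
Proof.
apply: (iffP allP) => [cu [i a] [j b] xu yu /= ij|cu x xu].
  rewrite -ij in yu *; congr (_, _); apply/eqP/negPn/negP => ab.
  have := cu _ xu; rewrite /label_opp /= (_ : ~~ a = b) ?yu //.
  by case: a b ab {xu yu} => -[].
by apply/negP => /(cu _ _ xu)/(_ erefl)/(congr1 snd)/=; case: (x.2).
Qed.

Fixpoint alternating (b : bool) (s : seq bool) : bool :=
  if s is c :: s' then (c == b) && alternating (~~ b) s' else true.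

Lemma alternating_map_negb b s :
    alternating b (map negb s) = alternating (~~ b) s.
Proof. by elim: s b => //= c s IH b; rewrite IH; case: b c => -[]. Qed.

(** Counting deletions that leave a sequence alternating from [b]: if [s] alternates from [b], the
    last entry can be deleted; if it alternates from [~~ b], the first. Any other sequence admits no
    such deletion or exactly two, at the two places of its only repetition, and these cancel modulo
    2. *)
Lemma coboundary_alternating b s : s != [::] ->
  coboundary (fun u => (alternating b u)%:R : 'F_2) s =
  (alternating b s)%:R + (alternating (~~ b) s)%:R.
Proof.
have N2 (x : 'F_2) : - x = x by case: x => -[|[|m]] // xm; apply: val_inj.
elim: s b => [//|c s IH] b _ /=.
rewrite (_ : coboundary _ s =
  (c == b)%:R * coboundary (fun u => (alternating (~~ b) u)%:R : 'F_2) s);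
  last first.
  have [->|cb] := eqVneq c b.
    by rewrite mulr1n mul1r; apply: eq_coboundary => u _; rewrite /= eqxx.
  rewrite mulr0n mul0r coboundaryE big1 // => i _.
  by rewrite /= (negPf cb) mulr0.
case: s IH => [_|d s /(_ (~~ b) isT) ->].
  by rewrite [coboundary _ _]/= mulr0 subr0; case: b c => -[]; apply/eqP;
    vm_compute.
rewrite !negbK N2.
by move: (alternating b _) (alternating (~~ b) _) => -[] [];
  case: b c {N2} => -[];
  apply/eqP; vm_compute.
Qed.

(* The cochain of Fan's combinatorial lemma. *)
Definition fan (u : seq label) : bool :=
  alternating false (map snd (sort label_le u)).

Lemma fan_perm u v : perm_eq u v -> fan u = fan v.
Proof.
by move/(perm_sortP label_le_total label_le_trans label_le_anti) => e;
  rewrite /fan e.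
Qed.

Lemma fan_sorted u : sorted label_le u -> fan u = alternating false (map snd u).
Proof. by move/(sorted_sort label_le_trans) => e; rewrite /fan e. Qed.

Lemma perm_rem (T : eqType) (x : T) s t :
  perm_eq s t -> perm_eq (rem x s) (rem x t).
Proof.
move=> st; have [xs|xs] := boolP (x \in s); last first.
  by rewrite !rem_id // -(perm_mem st).
have xt : x \in t by rewrite -(perm_mem st).
rewrite -(perm_cons x); apply: perm_trans (perm_to_rem xt).
by apply: perm_trans st; rewrite perm_sym perm_to_rem.
Qed.

(** Modulo 2 the signs disappear, and deleting any occurrence of [x] gives a permutation of
    [rem x s]. The coboundary thus no longer depends on the order of the entries. *)
Lemma coboundary_perm_invariant (T : eqType) (phi : seq T -> 'F_2) :
  (forall u v, perm_eq u v -> phi u = phi v) ->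
  forall s, coboundary phi s = \sum_(x <- s) phi (rem x s).
Proof.
have N2 (x : 'F_2) : - x = x by case: x => -[|[|m]] // xm; apply: val_inj.
move=> phiP s; elim: s phi phiP => [|x s IH] phi phiP; first by rewrite big_nil.
rewrite big_cons /= eqxx N2 IH => [|u v uv]; last first.
  by apply: phiP; rewrite perm_cons.
congr (_ + _); apply: eq_big_seq => y ys.
by apply: phiP; case: eqVneq => [->|//]; rewrite perm_sym perm_to_rem.
Qed.

(** Sorting reduces this to sequences of signs. Negating the labels keeps them sorted: in a
    complement-free tuple, labels with the same index are equal. *)
Lemma coboundary_fan u : u != [::] -> complement_free u ->
  coboundary (fun v => (fan v)%:R : 'F_2) u =
  (fan u)%:R + (fan (map label_opp u))%:R.
Proof.
move=> u0 cu.
have phiP (v w : seq label) : perm_eq v w -> (fan v)%:R = (fan w)%:R :> 'F_2.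
  by move/fan_perm ->.
set s := sort label_le u.
have us : perm_eq s u by rewrite perm_sort.
have ss : sorted label_le s := sort_sorted label_le_total u.
have s0 : s != [::] by rewrite -size_eq0 (perm_size us) size_eq0.
have cs : complement_free s by rewrite (complement_free_perm us).
have -> : coboundary (fun v => (fan v)%:R : 'F_2) u =
          coboundary (fun v => (fan v)%:R : 'F_2) s.
  rewrite !(coboundary_perm_invariant phiP) -(perm_big _ us) /=.
  apply: eq_big_seq => x xs; apply: phiP.
  by rewrite perm_rem // perm_sym.
have -> : fan u = alternating false (map snd s) by [].
have -> : fan (map label_opp u) = alternating true (map snd s).
  rewrite -(fan_perm (perm_map label_opp us)) fan_sorted.
    rewrite -map_comp -(alternating_map_negb false) -map_comp.
    by [].
  rewrite sorted_map; apply: (sub_in_sorted _ (allss s)) ss.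
  move=> x y xs ys; rewrite /label_le /=.
  case: ltngtP => //= xy _; move/complement_freeP: cs => /(_ x y xs ys xy) ->.
  by case: (y.2).
rewrite -coboundary_alternating; last by case: (s) s0.
rewrite -coboundary_map; apply: eq_in_coboundary => v _ vs /=.
by rewrite fan_sorted // (subseq_sorted label_le_trans vs).
Qed.

(** * Determinants as cochains *)

Lemma nth_take_drop (T : Type) (x0 : T) (u : seq T) i a : (i < size u)%N ->
  nth x0 (take i u ++ drop i.+1 u) a = nth x0 u (bump i a).
Proof.
move=> iu; rewrite nth_cat size_take iu /bump; have [ai|ai] := leqP i a.
  by rewrite add1n nth_drop; congr nth; lia.
by rewrite add0n nth_take.
Qed.

(** The two dependences met below: a label that does not occur gives a zero column, and if every row
    has one matching label, the columns add up to the distinguished one. *)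
Lemma det_dependent_col m (D : 'M[int]_m.+1) (j : 'I_m.+1) :
  (exists l, forall i, D i (lift j l) = 0) \/
  (forall i, D i j = \sum_l D i (lift j l)) -> \det D = 0.
Proof.
case=> [[l Dl]|Dj].
  by rewrite (expand_det_col _ (lift j l)) big1 // => i _; rewrite Dl mul0r.
rewrite -det_tr; apply/eqP/det0P.
exists (\row_l if l == j then 1 else -1).
  apply/eqP => /rowP /(_ j); rewrite !mxE eqxx => /eqP.
  by rewrite oner_eq0.
apply/rowP => i; rewrite !mxE (bigD1_ord j) //= !mxE eqxx mul1r Dj.
apply/eqP; rewrite addr_eq0 -sumrN; apply/eqP; apply: eq_bigr => l _.
by rewrite !mxE eq_sym (negPf (neq_lift _ _)) mulN1r opprK.
Qed.

Definition label0 : label := (0%N, false).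

(** For injective [tau] and [size u = m], this is the sign of the permutation that arranges [tau] as
    [u], and [0] if there is none: the cochain dual to the oriented simplex [tau]. *)
Definition det_cochain m (tau : 'I_m -> label) (u : seq label) : int :=
  \det (\matrix_(i, j) (nth label0 u i == tau j)%:R).

Definition cone_matrix m (j : 'I_m.+1) (tau : 'I_m -> label) (u : seq label) :
    'M[int]_m.+1 :=
  \matrix_(i, l) if unlift j l is Some l' then
    (nth label0 u i == tau l')%:R else 1.

(** Expansion along the column of ones is the alternating sum over deleted rows; the sign accounts
    for the position of that column. *)
Lemma coboundary_det_cochain m (j : 'I_m.+1) (tau : 'I_m -> label) u :
  size u = m.+1 ->
  coboundary (det_cochain tau) u = (-1) ^+ j * \det (cone_matrix j tau u).
Proof.
move=> um; rewrite coboundaryE um (expand_det_col _ j) big_distrr /=.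
apply: eq_bigr => i _; rewrite !mxE unlift_none mul1r /cofactor mulrA.
rewrite -exprD addnCA addnn -mul2n exprD exprM sqrrN !expr1n mulr1.
congr (_ * \det _); apply/matrixP => a b; rewrite !mxE liftK.
by rewrite nth_take_drop ?um.
Qed.

Definition fan_label (j : nat) : label := (j, odd j).

Definition facet_cochain m : seq label -> int :=
  det_cochain (fun j : 'I_m => fan_label j).

Lemma in_nth_label u m (i : 'I_m) : size u = m -> nth label0 u i \in u.
Proof. by move=> um; rewrite mem_nth // um. Qed.

(** If all the labels belong to the facet, the column of ones is the sum of the others. Otherwise
    some label of [u] is opposite to a label of the facet, which then does not occur and has a zero
    column. *)
Lemma facet_cochain_cocycle m u : size u = m.+1 ->
  {in u, forall x, x.1 < m}%N -> complement_free u ->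
  coboundary (facet_cochain m) u = 0.
Proof.
move=> um uB cu; rewrite (coboundary_det_cochain ord0) //
  (@det_dependent_col _ _ ord0) ?mulr0 //.
have [/allP all_fan|] := boolP (all (fun x => x == fan_label x.1) u).
  right=> i; rewrite mxE unlift_none.
  have xu := in_nth_label i um; set x := nth _ _ _ in xu.
  rewrite (bigD1 (Ordinal (uB x xu))) //= mxE liftK -/x all_fan // big1 ?addr0
    //.
  move=> l lx; rewrite mxE liftK -/x; case: eqP => // xl; case/eqP: lx.
  by apply: val_inj; rewrite /= xl.
case/allPn=> x xu xN; left; exists (Ordinal (uB x xu)) => i;
  rewrite mxE liftK /=.
case: eqP => // e; move/complement_freeP: cu => /(_ _ x (in_nth_label i um) xu).
by rewrite e => /(_ erefl) e'; rewrite -e' eqxx in xN.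
Qed.

(** Reflection negates the facet cochain up to a coboundary. The matrices of [map (label_flip j) u],
    of [u] and of the cone differ only in column [j], and there the cone minus the other two is the
    indicator of an index other than [j]. With that column the matrix [D] is singular, for the
    reasons of [facet_cochain_cocycle]. *)
Lemma facet_cochain_flip m (j : 'I_m.+1) u : size u = m.+1 ->
  {in u, forall x, x.1 < m.+1}%N -> complement_free u ->
  facet_cochain m.+1 (map (label_flip j) u) = - facet_cochain m.+1 u +
    (-1) ^+ j * coboundary (det_cochain (fun l => fan_label (lift j l))) u.
Proof.
move=> um uB cu; rewrite (coboundary_det_cochain j) // mulrA -exprD addnn.
rewrite -mul2n exprM sqrrN !expr1n mul1r.
set B := cone_matrix _ _ _.
pose D : 'M[int]_m.+1 := \matrix_(i, l) if l == j then
  ((nth label0 u i).1 != j)%:R else (nth label0 u i == fan_label l)%:R.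
pose M v : 'M[int]_m.+1 := \matrix_(i, l) (nth label0 v i == fan_label l)%:R.
rewrite /facet_cochain /det_cochain -!/(M _).
suff D0 : \det D = 0.
  apply/eqP; rewrite -subr_eq0 opprD opprK addrA; apply/eqP.
  rewrite -[RHS]oppr0 -D0 !(expand_det_col _ j).
  rewrite -big_split -!sumrB -sumrN /=; apply: eq_bigr => i _.
  have cofE (N : 'M[int]_m.+1) :
    (forall a l, N a (lift j l) = B a (lift j l)) ->
      cofactor N i j = cofactor B i j.
    move=> e; rewrite /cofactor; congr (_ * \det _); apply/matrixP => a l.
    by have := e (lift i a) l; rewrite !mxE.
  rewrite (cofE (M (map _ u))); last first.
    move=> a l; rewrite !mxE liftK (nth_map label0) ?um //;
      congr (nat_of_bool _)%:R.
    rewrite /label_flip; set x := nth _ _ _; have [aj|//] := eqVneq x.1 j.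
    have xl : x.1 != lift j l by rewrite aj (inj_eq val_inj) neq_lift.
    by case: x xl {aj} => a' s' /= xl; rewrite !xpair_eqE /= (negPf xl).
  rewrite (cofE (M u)); last by move=> a l; rewrite !mxE liftK.
  rewrite (cofE D); last first.
    by move=> a l; rewrite !mxE liftK eq_sym (negPf (neq_lift _ _)).
  rewrite !mxE unlift_none eqxx (nth_map label0) ?um //.
  rewrite -mulrDl -mulrBl -mulNr; congr (_ * _).
  rewrite /label_flip; case: (nth _ _ _) => a s /=; rewrite /fan_label.
  rewrite /label_opp /=; have [->|aj] := eqVneq a j.
    by rewrite !xpair_eqE /= eqxx; case: s; case: (odd _).
  by rewrite !xpair_eqE /= (negPf aj).
have lift_ex k : (k < m.+1)%N -> k <> j -> exists l : 'I_m, lift j l = k :> nat.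
  move=> km kj; case: (unliftP j (Ordinal km)) => [l e|/(congr1 val)//].
  by exists l; rewrite -e.
apply: (@det_dependent_col _ _ j).
have [/allP all_fan|] := boolP
  (all (fun x : label => (x.1 == j :> nat) || (x == fan_label x.1)) u).
  right=> i; rewrite mxE eqxx.
  have xu := in_nth_label i um; set x := nth _ _ _ in xu *.
  have D_lift l : D i (lift j l) = (x == fan_label (lift j l))%:R.
    by rewrite mxE eq_sym (negPf (neq_lift _ _)).
  have [xj|xj] /= := eqVneq x.1 (j : nat).
    rewrite big1 // => l _; rewrite D_lift; case: eqP => // /(congr1 fst) /= e.
    by have := neq_lift j l; rewrite -val_eqE /= -e xj eqxx.
  have [l lx] := lift_ex _ (uB x xu) (elimN eqP xj).
  rewrite (bigD1 l) //= D_lift lx.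
  have := all_fan x xu; rewrite (negPf xj) /= => ->.
  rewrite big1 ?addr0 // => l' l'l; rewrite D_lift;
    case: eqP => // /(congr1 fst) /= e.
  case/eqP: l'l; apply: (@lift_inj _ j); apply: val_inj => /=.
  by rewrite -e.
case/allPn=> x xu; rewrite negb_or => /andP[xj xN].
have [l lx] := lift_ex _ (uB x xu) (elimN eqP xj).
left; exists l => i; rewrite mxE eq_sym (negPf (neq_lift _ _)) lx.
case: eqP => // e; move/complement_freeP: cu => /(_ _ x (in_nth_label i um) xu).
by rewrite e => /(_ erefl) e'; rewrite -e' eqxx in xN.
Qed.

Lemma alternating_odd m k : alternating (odd m) (map odd (iota m k)).
Proof. by elim: k m => //= k IH m; rewrite eqxx /=; have := IH m.+1. Qed.

Lemma alternatingE b s : alternating b s ->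
  forall i, (i < size s)%N -> nth b s i = b (+) odd i.
Proof.
elim: s b => //= c s IH b /andP[/eqP -> sb] [|i] /=; first by rewrite addbF.
rewrite ltnS => /[dup] isz /(IH _ sb); rewrite (set_nth_default b) // => ->.
by case: b {sb IH}; case: (odd i).
Qed.

(** Alternation forbids equal neighbours after sorting, and complement-freeness then makes the
    indices strictly increasing. As there are [m] of them below [m], they are [0, ..., m - 1]. *)
Lemma fan_facet m u : size u = m -> {in u, forall x, x.1 < m}%N ->
  complement_free u -> fan u = perm_eq u (map fan_label (iota 0 m)).
Proof.
move=> um uB cu; apply/idP/idP => [fu|up]; last first.
  rewrite (fan_perm up) fan_sorted.
    by rewrite -map_comp; exact: (alternating_odd 0).
  rewrite sorted_map; apply: sub_sorted (iota_ltn_sorted 0 m) => i j /= ij.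
  by rewrite /label_le /= ij.
pose s := sort label_le u.
have su : perm_eq s u by rewrite perm_sort.
have ss : sorted label_le s := sort_sorted label_le_total u.
have cs : complement_free s by rewrite (complement_free_perm su).
have sm : size s = m by rewrite (perm_size su).
have s1 : map fst s = iota 0 m.
  have lts : sorted ltn (map fst s).
    rewrite sorted_map; move: fu cs ss; rewrite /fan -/s.
    move: false; elim: s {su sm} => //= x [//|y s] IH b /= /andP[xb alts] cs.
    move=> /andP[xy ys]; move/complement_freeP: cs => cs.
    have cys : complement_free (y :: s).
      by apply/complement_freeP => a c av cv; apply: cs;
        rewrite inE ?av ?cv orbT.
    have /= -> := IH (~~ b) alts cys ys.
    rewrite andbT; case/orP: xy => // /andP[/eqP xy _].
    case/andP: alts; rewrite -(cs x y) ?inE ?eqxx ?orbT // (eqP xb).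
    by case: b {xb IH}.
  apply: (irr_sorted_eq ltn_trans ltnn lts (iota_ltn_sorted 0 m)).
  have us : uniq (map fst s) := sorted_uniq ltn_trans ltnn lts.
  have sub : {subset map fst s <= iota 0 m}.
    by move=> _ /mapP[x xs ->]; rewrite mem_iota /= uB // -(perm_mem su).
  by have [] := uniq_min_size us sub; rewrite size_iota size_map sm.
rewrite -(permPl su); suff -> : s = map fan_label (iota 0 m) by [].
apply: (@eq_from_nth _ label0) => [|i im];
  first by rewrite sm size_map size_iota.
have im' : (i < m)%N by rewrite -sm.
rewrite (nth_map 0%N) ?size_iota // nth_iota // add0n /fan_label.
rewrite [LHS]surjective_pairing; congr (_, _).
  by rewrite -(nth_map _ 0%N) // s1 nth_iota.
rewrite -(nth_map _ false) //; have := alternatingE fu.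
by rewrite -/s size_map sm => ->.
Qed.

(** Links the integral degree to Fan's lemma. A permutation matrix has determinant 1 modulo 2; if
    [u] does not arrange the facet, some label of the facet is missing and its column vanishes. *)
Lemma facet_cochain_fan m u : size u = m -> {in u, forall x, x.1 < m}%N ->
  complement_free u -> (facet_cochain m u)%:~R = (fan u)%:R :> 'F_2.
Proof.
move=> um uB cu; rewrite (fan_facet um) //; have [|uN] := boolP (perm_eq _ _).
  have -> : map fan_label (iota 0 m) = [tuple fan_label i | i < m].
    by rewrite -val_enum_ord -map_comp.
  case/tuple_permP => p up; rewrite /facet_cochain /det_cochain.
  rewrite (_ : \matrix_(i, j) _ = perm_mx p); last first.
    apply/matrixP => i j; rewrite !mxE up -tnth_nth !tnth_mktuple eq_sym.
    by rewrite xpair_eqE (inj_eq val_inj) eq_sym andb_idr // => /eqP ->.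
  by rewrite det_perm rmorphXn rmorphN1 (_ : -1 = 1) ?expr1n //; apply: val_inj.
have [sub|] := boolP (all (mem u) (map fan_label (iota 0 m))); last first.
  case/allPn => _ /mapP[j jm ->] ju; rewrite mem_iota /= add0n in jm.
  rewrite /facet_cochain /det_cochain (expand_det_col _ (Ordinal jm)).
  rewrite big1 ?rmorph0 // => i _; rewrite mxE; case: eqP => [e|_];
    last by rewrite mul0r.
  by case/negP: ju; rewrite -[fan_label j]e /= in_nth_label.
case/negP: uN; have sub' := elimT allP sub.
have un : uniq (map fan_label (iota 0 m)).
  by rewrite map_inj_uniq ?iota_uniq // => i j [].
have le : (size u <= size (map fan_label (iota 0 m)))%N.
  by rewrite size_map size_iota um.
rewrite perm_sym; apply: uniq_perm => //;
  first exact: (leq_size_uniq un sub' le).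
by have [] := uniq_min_size un sub' le.
Qed.

(** * The degree of a map between spheres *)

Section VectorLabel.
Variables (R : realType) (n : nat).
Implicit Types (v w : 'rV[R]_n.+1).

Lemma coord_le_norm m (v : 'rV[R]_m) j : `|v 0 j| <= `|v|.
Proof.
by rewrite [leRHS]/Num.norm /= mx_normrE; apply/bigmax_geP; right => /=;
  exists (0, j).
Qed.

Definition max_coord v : 'I_n.+1 := [arg max_(j > ord0) `|v 0 j|]%O.

Lemma max_coordE v : `|v 0 (max_coord v)| = `|v|.
Proof.
apply/eqP; rewrite eq_le coord_le_norm /= [leLHS]/Num.norm /= mx_normrE.
apply/bigmax_leP; split=> // -[i j] _ /=; rewrite ord1 /max_coord.
by case: arg_maxP => // k _; apply.
Qed.

(** Ties are broken by the absolute values alone, hence equivariantly under changes of sign. *)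
Lemma eq_max_coord v w : (forall j, `|v 0 j| = `|w 0 j|) ->
    max_coord v = max_coord w.
Proof. by move=> e; rewrite /max_coord
  (_ : (fun j => `|v 0 j|) = (fun j => `|w 0 j|)) //; apply/funext. Qed.

Definition vector_label v : label := (val (max_coord v), v 0 (max_coord v) < 0).

Lemma max_coord_neq0 v : v != 0 -> v 0 (max_coord v) != 0.
Proof. by move=> v0; rewrite -normr_eq0 max_coordE normr_eq0. Qed.

Lemma vector_labelN v : v != 0 ->
    vector_label (- v) = label_opp (vector_label v).
Proof.
move=> v0; rewrite /vector_label (_ : max_coord (- v) = max_coord v).
  by rewrite mxE oppr_lt0 /label_opp /= -leNgt le_eqVlt eq_sym
    (negPf (max_coord_neq0 v0)).
by apply: eq_max_coord => j; rewrite mxE normrN.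
Qed.

Definition flip_coord (j : 'I_n.+1) v : 'rV[R]_n.+1 :=
  \row_i (if i == j then - v 0 i else v 0 i).

Lemma vector_label_flip j v : v != 0 ->
  vector_label (flip_coord j v) = label_flip j (vector_label v).
Proof.
move=> v0; rewrite /vector_label (_ : max_coord (flip_coord j v) = max_coord v).
  rewrite mxE /label_flip /= (inj_eq val_inj); case: ifP => // _.
  by rewrite oppr_lt0 /label_opp /= -leNgt le_eqVlt eq_sym
    (negPf (max_coord_neq0 v0)).
by apply: eq_max_coord => i; rewrite mxE; case: ifP; rewrite ?normrN.
Qed.

(** The norm is the maximum norm. With opposite labels, [v] and [w] would have opposite signs at the
    coordinate where [v] attains its norm, and so be at distance at least [|v|]. *)
Lemma vector_label_close v w : `|v - w| < `|v| ->
  vector_label w <> label_opp (vector_label v).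
Proof.
move=> vw [jj s].
have := le_lt_trans (coord_le_norm (v - w) (max_coord v)) vw.
rewrite !mxE -max_coordE; move: s; rewrite (_ : max_coord w = max_coord v).
  set a := v _ _; set b := w _ _.
  case: (ltP b 0) => /= b0; case: (ltP a 0) => //= a0 _.
    by rewrite !ger0_norm //; lra.
  by rewrite !ler0_norm ?ltW //; lra.
exact: val_inj.
Qed.

Lemma vector_label_bound v : ((vector_label v).1 < n.+1)%N.
Proof. exact: ltn_ord. Qed.

End VectorLabel.

Section Shell.
Variables (R : realType) (n : nat).
Local Notation W := 'rV[R]_n.+1.

(** A compact set that avoids the origin and contains the boundary of the cross-polytope, where the
    [n.+1] absolute values of the coordinates add up to 1. *)
Definition shell : set W := [set x | n.+1%:R^-1 <= `|x| /\ `|x| <= 1].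

Lemma shell_neq0 x : shell x -> x != 0.
Proof.
case=> x1 _; rewrite -normr_gt0; apply: lt_le_trans x1.
by rewrite invr_gt0 ltr0n.
Qed.

Lemma shell_compact : compact shell.
Proof.
apply: bounded_closed_compact.
  by exists 1; split; rewrite ?num_real // => M M1 x [_ /le_trans]; apply;
    exact: ltW.
have -> : shell = [set x | n.+1%:R^-1 <= `|x|] `&` [set x | `|x| <= 1] by [].
apply: closedI.
  by apply: (closed_comp (f := fun x : W => `|x|)) (@closed_ge R _) => x _;
    exact: norm_continuous.
by apply: (closed_comp (f := fun x : W => `|x|)) (@closed_le R _) => x _;
  exact: norm_continuous.
Qed.

(* The facets of the cross-polytope are the sets of [x] with [|x| <= 1] and
   [\sum_j +-x_j = 1]. *)
Definition facet_hull (b : nat -> bool) (x : W) : Prop :=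
  `|x| <= 1 /\ \sum_(j < n.+1) (-1) ^+ b j * x 0 j = 1.

Lemma facet_hull_shell b x : facet_hull b x -> shell x.
Proof.
case=> x1 sx; split=> //; rewrite -[leLHS]mulr1 ler_pdivrMl ?ltr0n // -{1}sx.
apply: (le_trans (ler_norm _)); apply: (le_trans (ler_norm_sum _ _ _)).
apply: (@le_trans _ _ (\sum_(j < n.+1) `|x|)).
  by apply: ler_sum => j _; rewrite normrM normrX normrN1 expr1n mul1r
    coord_le_norm.
by rewrite sumr_const card_ord mulr_natl.
Qed.

Lemma facet_hull_barycenter b : barycenter_closed (facet_hull b).
Proof.
move=> s s0 sb; split.
  have := @ball_barycenter_closed R W 0 1 s s0; rewrite /= sub0r normrN; apply.
  by move=> x /sb[]; rewrite sub0r normrN.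
rewrite /barycenter.
under eq_bigr do rewrite mxE summxE mulrCA big_distrr /=.
rewrite -big_distrr exchange_big /=.
rewrite (eq_big_seq (fun=> 1)); last by move=> x /sb[].
rewrite big_const_seq count_predT iter_addr_0 mulVf //.
by rewrite pnatr_eq0 size_eq0.
Qed.

Definition axis (i : nat) : W := \row_j (val j == i)%:R.

Lemma axis_facet_hull b m x :
    (m <= n.+1)%N -> x \in cross_facet axis b m -> facet_hull b x.
Proof.
elim: m => // m IH mn; rewrite inE => /predU1P[->|]; last exact/IH/ltnW.
have N1 : `|axis m| <= 1.
  rewrite /Num.norm /= mx_normrE; apply/bigmax_leP; split=> // -[i j] _ /=.
  by rewrite mxE; case: (_ == _); rewrite ?normr1 ?normr0.
split; first by case: (b m); rewrite ?normrN.
rewrite (bigD1 (Ordinal mn)) //= big1 ?addr0 => [|j jm].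
  by case: (b m); rewrite !mxE eqxx ?expr1 ?expr0 ?mulrNN mulr1.
have jm' : (val j == m) = false by apply/negbTE; move: jm; rewrite -val_eqE.
by case: (b m); rewrite !mxE /= jm' ?oppr0 mulr0.
Qed.

Lemma facet_hull_diameter b s :
    {in s, forall x, facet_hull b x} -> diameter_le 2 s.
Proof.
move=> sb x y /sb[x1 _] /sb[y1 _]; apply: (le_trans (ler_normB _ _)).
by rewrite (_ : 2 = 1 + 1) // lerD.
Qed.

Lemma mesh_small (e : R) : 0 < e -> exists N0, forall N, (N0 <= N)%N ->
  mesh_ratio R n.+1 ^+ N * 2 < e.
Proof.
move=> e0; have r1 : `|mesh_ratio R n.+1| < 1.
  rewrite ger0_norm; first by rewrite ltrBlDr ltrDl invr_gt0 ltr0n.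
  by rewrite subr_ge0 invf_le1 ?ler1n ?ltr0n.
have e2 : 0 < e / 2 by rewrite divr_gt0.
have /cvgrPdist_lt /(_ _ e2) [N0 _ N0P] := cvg_expr r1.
exists N0 => N /N0P /=; rewrite sub0r normrN => /ltr_normlW.
by rewrite ltr_pdivlMr.
Qed.

End Shell.

Arguments vector_label {R n} v.

Section IterSubdivision.
Variables (A : comNzRingType) (F : fieldType) (W : lmodType F).
Implicit Types (phi psi : seq W -> A).
Local Notation sd := (@subdivision A F W).

Lemma iter_subdivisionD N phi psi :
  iter N sd (fun u => phi u + psi u) = fun u =>
    iter N sd phi u + iter N sd psi u.
Proof.
elim: N => //= N ->; apply/funext => u; exact: subdivisionD.
Qed.

Lemma iter_subdivision_coboundary N phi :
  iter N sd (coboundary phi) = coboundary (iter N sd phi).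
Proof.
elim: N => //= N ->; apply/funext => u; exact: subdivision_coboundary.
Qed.

Lemma iter_subdivision_opp N phi :
  iter N sd (phi \o map -%R) = iter N sd phi \o map -%R.
Proof.
elim: N => //= N ->; apply/funext => u; exact: subdivision_opp.
Qed.

Lemma iter_subdivision_nil N phi : iter N sd phi [::] = phi [::].
Proof. by elim: N => //= N. Qed.

End IterSubdivision.

Lemma iter_subdivision_rmorph (A B : comNzRingType) (h : {rmorphism A -> B})
    (F : fieldType) (W : lmodType F) N (phi : seq W -> A) :
  iter N (@subdivision B F W) (h \o phi) = h \o iter N (@subdivision A F W) phi.
Proof.
elim: N => //= N ->; apply/funext => u; exact: subdivision_rmorph.
Qed.

Section Degree.
Variables (R : realType) (n : nat).
Local Notation W := 'rV[R]_n.+1.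
Local Notation sd A := (@subdivision A R W).
Local Notation S := (@shell R n).
Implicit Types (G : W -> W).

(* The degree of [G] on the boundary of the cross-polytope, provided that the
   [N]-th barycentric subdivision is fine enough for [G]. *)
Definition degree N G : int :=
  cross_cycle (@axis R n) n.+1
    (iter N (sd int) (facet_cochain n.+1 \o map (vector_label \o G))).

(** The factor 2 bounds the diameter of a facet ([facet_hull_diameter]). *)
Definition mesh N : R := mesh_ratio R n.+1 ^+ N * 2.

Lemma eq_subdivided (A : comNzRingType) N (phi psi : seq W -> A) b m :
  (m <= n.+1)%N ->
  (forall u, size u = m -> {in u, forall x, S x} -> diameter_le (mesh N) u ->
     phi u = psi u) ->
  iter N (sd A) phi (cross_facet (@axis R n) b m) =
  iter N (sd A) psi (cross_facet (@axis R n) b m).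
Proof.
move=> mn phipsi; set s := cross_facet _ _ _.
have sb : {in s, forall x, facet_hull b x}.
  by move=> x; exact: axis_facet_hull.
have sm : size s = m by rewrite size_cross_facet.
apply: (@eq_iter_subdivision R W A n.+1 N (facet_hull b) 2) => //.
- by rewrite sm.
- exact: facet_hull_barycenter.
- exact: facet_hull_diameter sb.
move=> u us uC du; apply: phipsi => //; first by rewrite us.
by move=> x /uC; exact: facet_hull_shell.
Qed.

Lemma eq_degree N G G' : {in S, G =1 G'} -> degree N G = degree N G'.
Proof.
move=> GG'; apply: eq_cross_cycle => b; apply: eq_subdivided => // u _ uS _ /=.
congr facet_cochain; apply/eq_in_map => x /uS xS /=.
by rewrite GG' // inE.
Qed.

Lemma vector_label_lt G u :
    {in map (vector_label \o G) u, forall x, x.1 < n.+1}%N.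
Proof. by move=> _ /mapP[x _ ->]; exact: vector_label_bound. Qed.

Definition label_compatible (e : R) (G G' : W -> W) :=
  forall x y, S x -> S y -> `|x - y| <= e ->
    vector_label (G y) <> label_opp (vector_label (G' x)).

Lemma complement_free_map e G u : label_compatible e G G ->
  {in u, forall x, S x} -> diameter_le e u ->
  complement_free (map (vector_label \o G) u).
Proof.
move=> lc uS du; apply/allP => _ /mapP[x xu ->]; apply/negP => /mapP[y yu].
by move/esym; apply: lc; [exact: uS|exact: uS|exact: du].
Qed.

(** The prism between the two labellings has complement-free labels, on which the facet cochain is a
    cocycle. Hence the two pulled back cochains differ by a coboundary, which the cycle kills. *)
Lemma degree_step N G G' : label_compatible (mesh N) G G ->
  label_compatible (mesh N) G G' -> label_compatible (mesh N) G' G ->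
  label_compatible (mesh N) G' G' -> degree N G = degree N G'.
Proof.
move=> lc00 lc01 lc10 lc11.
pose a := vector_label \o G; pose a' := vector_label \o G'.
pose om := facet_cochain n.+1.
have -> : degree N G' = cross_cycle (@axis R n) n.+1 (iter N (sd int)
    (fun u => (om \o map a) u + coboundary (prism a a' om) u)).
  apply: eq_cross_cycle => b; apply: eq_subdivided => // u un uS du /=.
  have : prism a a' (coboundary om) u = 0.
    apply: (@prism_eq0 _ _ _ _ _
      (fun y => exists2 x, x \in u & y = a x \/ y = a' x)).
      by move=> x xu; split; exists x => //; [left|right].
    move=> v; rewrite un => vn vP; apply: facet_cochain_cocycle => //.
      by move=> y /vP[x _ [] ->]; exact: vector_label_bound.
    apply/allP => y /vP[x xu yE]; apply/negP => /vP[z zu zE].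
    have [xS zS] := (uS x xu, uS z zu).
    by case: yE zE => -> [] /esym;
      [apply: lc00|apply: lc10|apply: lc01|apply: lc11];
      rewrite ?xS ?zS //; apply: du.
  rewrite prism_coboundary => /eqP; rewrite subr_eq0 subr_eq => /eqP.
  by rewrite addrC.
by rewrite iter_subdivisionD iter_subdivision_coboundary cross_cycleD
  cross_cycle_coboundary addr0.
Qed.

(** On fine simplices [facet_cochain_flip] turns the sum of the two cochains into the coboundary of
    [beta]. *)
Lemma degree_flip N j G : {in S, forall x, G x != 0} ->
  label_compatible (mesh N) G G -> degree N (flip_coord j \o G) = - degree N G.
Proof.
move=> G0 lc; apply/eqP; rewrite -subr_eq0 opprK; apply/eqP.
rewrite -cross_cycleD.
pose beta : seq W -> int := fun u => (-1) ^+ j *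
  det_cochain (fun l => fan_label (lift j l)) (map (vector_label \o G) u).
rewrite -[RHS](cross_cycle_coboundary (@axis R n) n.+1 (iter N (sd int) beta)).
apply: eq_cross_cycle => b; rewrite -iter_subdivision_coboundary.
have := iter_subdivisionD N
  (facet_cochain n.+1 \o map (vector_label \o (flip_coord j \o G)))
  (facet_cochain n.+1 \o map (vector_label \o G)).
move/(congr1 (fun f => f (cross_facet (@axis R n) b n.+1))) => <-.
apply: eq_subdivided => // u un uS du.
have -> : coboundary beta u = (-1) ^+ j * coboundary
    (det_cochain (fun l => fan_label (lift j l))) (map (vector_label \o G) u).
  rewrite -coboundary_map; exact: coboundaryMl.
have /= fE := @facet_cochain_flip n j (map (vector_label \o G) u).
rewrite /= -[RHS](addrNK (facet_cochain n.+1 (map (vector_label \o G) u))).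
congr (_ + _); rewrite [RHS]addrC -fE.
- rewrite -map_comp; congr facet_cochain; apply/eq_in_map => x xu /=.
  by apply: vector_label_flip; apply: G0; rewrite inE; exact: uS.
- by rewrite size_map.
- exact: vector_label_lt.
- exact: complement_free_map lc uS du.
Qed.

(** Modulo 2 the facet cochain may be replaced by [fan]. Since antipodal points carry opposite
    labels, [coboundary_fan] is the hypothesis of [cross_cycle_odd]. *)
Lemma degree_odd N G : {in S, forall x, G x != 0} ->
  {in S, forall x, G (- x) = - G x} -> label_compatible (mesh N) G G ->
  (degree N G)%:~R = 1 :> 'F_2.
Proof.
move=> G0 Godd lc; rewrite /degree
  -[LHS](cross_cycle_rmorph (intr : {rmorphism int -> 'F_2})).
pose alpha : seq W -> 'F_2 := fun u => (fan (map (vector_label \o G) u))%:R.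
transitivity (cross_cycle (@axis R n) n.+1 (iter N (sd 'F_2) alpha)).
  rewrite -(iter_subdivision_rmorph (intr : {rmorphism int -> 'F_2})).
  apply: eq_cross_cycle => b; apply: eq_subdivided => // u un uS du /=.
  apply: facet_cochain_fan; first by rewrite size_map.
    exact: vector_label_lt.
  exact: complement_free_map lc uS du.
apply: cross_cycle_odd => [||i b im s].
- exact: val_inj.
- by rewrite iter_subdivision_nil.
have -> : iter N (sd 'F_2) alpha s + iter N (sd 'F_2) alpha (map -%R s) =
    iter N (sd 'F_2) (fun u => alpha u + (alpha \o map -%R) u) s.
  by rewrite iter_subdivisionD iter_subdivision_opp.
rewrite -iter_subdivision_coboundary; apply: eq_subdivided => // u ui uS du.
rewrite (coboundary_map (vector_label \o G) (fun v => (fan v)%:R))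
  coboundary_fan.
- congr (_ + (fan _)%:R); rewrite -!map_comp; apply/eq_in_map => x xu /=.
  have xS : x \in S by rewrite inE; exact: uS.
  by rewrite Godd // vector_labelN // G0.
- by rewrite -size_eq0 size_map ui.
- exact: complement_free_map lc uS du.
Qed.

End Degree.

(* Unfolding [degree] makes conversion checks diverge. *)
Global Opaque degree.

(** * Homotopy invariance of the degree *)

Section DegreeHomotopy.
Variables (R : realType) (n : nat).
Local Notation W := 'rV[R]_n.+1.
Local Notation S := (@shell R n).
Implicit Types (H : R * W -> W).

Lemma label_compatible_uniform H :
  {within `[0, 1] `*` S, continuous H} ->
  (forall t x, 0 <= t <= 1 -> S x -> H (t, x) != 0) ->
  exists2 e : R, 0 < e & forall t t' : R,
    0 <= t <= 1 -> 0 <= t' <= 1 -> `|t - t'| <= e ->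
    label_compatible e (fun x => H (t', x)) (fun x => H (t, x)).
Proof.
move=> Hc H0; pose K : set (R * W) := `[0, 1] `*` S.
have Kc : compact K by apply: compact_setX;
  [exact: segment_compact|exact: shell_compact].
pose P (e : R) (p : R * W) :=
  K p -> forall q : R * W, K q -> `|p.1 - q.1| <= e -> `|p.2 - q.2| <= e ->
  vector_label (H q) <> label_opp (vector_label (H p)).
(* By compactness it is enough to find a bound near each point [p0]. *)
have KP : \forall e \near 0^'+, K `<=` P e.
  move/compact_near_coveringP: Kc; apply => p0 Kp0.
  have G0 : 0 < `|H p0|.
    by case: p0 Kp0 => t x [/= t01 Sx]; rewrite normr_gt0 H0 // -in_itv.
  (* If [H p] and [H q] are within a third of [|H p0|] of [H p0], then they are closer to each other
     than [|H p|], as [vector_label_close] requires. *)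
  have eta0 : 0 < `|H p0| / 3 by rewrite divr_gt0.
  have := (subspace_continuousP _ _).1 Hc p0 Kp0.
  move/cvgrPdist_lt => /(_ _ eta0);
    rewrite near_withinE => -[[A1 A2] /=
    [/nbhs_ballP[e1 /= e10 A1e] /nbhs_ballP[e2 /= e20 A2e]] AP].
  pose e := Num.min e1 e2.
  have e0 : 0 < e by rewrite lt_min e10 e20.
  have eP (p : R * W) : K p -> ball p0.1 e p.1 -> ball p0.2 e p.2 ->
      `|H p0 - H p| < `|H p0| / 3.
    move=> Kp p1 p2; apply: (AP p) => //; split.
      by apply: A1e; apply: le_ball p1; rewrite ge_min lexx.
    by apply: A2e; apply: le_ball p2; rewrite ge_min lexx orbT.
  clear e20; have e20 : 0 < e / 2 by rewrite divr_gt0.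
  exists (ball p0 (e / 2), [set d : R | d < e / 2]) => /=.
    by split; [exact: nbhsx_ballx|exact: nbhs_right_lt].
  move=> [p d] [/= [pt px] de] Kp q Kq tq xq.
  have Hp : `|H p0 - H p| < `|H p0| / 3.
    apply: eP => //.
      by apply: (le_ball _ pt); lra.
    by apply: (le_ball _ px); lra.
  have Hq : `|H p0 - H q| < `|H p0| / 3.
    apply: eP => //.
      rewrite -ball_normE /= in pt *.
      by have := ler_distD p.1 p0.1 q.1; lra.
    rewrite -ball_normE /= in px *.
    by have := ler_distD p.2 p0.2 q.2; lra.
  apply: vector_label_close.
  have := ler_distD (H p0) (H p) (H q); rewrite [`|H p - H p0|]distrC.
  have := ler_normD (H p0 - H p) (H p); rewrite subrK.
  by lra.
have /filter_ex [e [e0 KPe]] : \forall e \near 0^'+, 0 < e /\ K `<=` P e.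
  by apply: filterI => //; exact: nbhs_right_gt.
exists e => // t t' t01 t'01 tt' x y Sx Sy xy.
by apply: (KPe (t, x)) => //; split=> //=; rewrite in_itv.
Qed.

(** The interval is cut into [M] steps of length at most the uniform [e], and [degree_step] applies
    to each. The bound holds for all large [N], so that several homotopies can share one
    subdivision. *)
Lemma degree_homotopy H :
  {within `[0, 1] `*` S, continuous H} ->
  (forall t x, 0 <= t <= 1 -> S x -> H (t, x) != 0) ->
  exists N0, forall N, (N0 <= N)%N ->
    (forall t, 0 <= t <= 1 ->
       label_compatible (mesh R n N) (fun x => H (t, x)) (fun x => H (t, x))) /\
    degree N (fun x => H (0, x)) = degree N (fun x => H (1, x)).
Proof.
move=> Hc H0; have [e e0 eP] := label_compatible_uniform Hc H0.
have [N0 N0P] := mesh_small n e0; exists N0 => N /N0P Ne.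
have lc t t' : 0 <= t <= 1 -> 0 <= t' <= 1 -> `|t - t'| <= e ->
    label_compatible (mesh R n N) (fun x => H (t', x)) (fun x => H (t, x)).
  move=> t01 t'01 tt' x y Sx Sy xy; apply: (eP t t') => //.
  by apply: (le_trans xy); exact: ltW.
have lct t : 0 <= t <= 1 ->
    label_compatible (mesh R n N) (fun x => H (t, x)) (fun x => H (t, x)).
  by move=> t01; apply: lc => //; rewrite subrr normr0 ltW.
split; first exact: lct.
pose M := (Num.truncn e^-1).+1.
have M0 : 0 < M%:R :> R by rewrite ltr0n.
have Me : M%:R^-1 <= e.
  rewrite -[leRHS]invrK lef_pV2 ?posrE ?invr_gt0 //.
  by apply: ltW; exact: truncnS_gt.
pose t k : R := k%:R / M%:R.
have t01 k : (k <= M)%N -> 0 <= t k <= 1.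
  by move=> kM; rewrite divr_ge0 ?ler0n //= ler_pdivrMr // mul1r ler_nat.
have step k : (k <= M)%N -> degree N (fun x => H (0, x)) =
  degree N (fun x => H (t k, x)).
  elim: k => [|k IH] kM; first by rewrite /t mul0r.
  have kM' := ltnW kM; rewrite (IH kM').
  have tt : `|t k - t k.+1| <= e.
    rewrite (_ : t k - t k.+1 = - M%:R^-1); last by rewrite /t -natr1; ring.
    by rewrite normrN ger0_norm ?invr_ge0 ?ler0n.
  have tt' : `|t k.+1 - t k| <= e by rewrite distrC.
  have [tk tk'] := (t01 k kM', t01 k.+1 kM).
  by apply: degree_step; [exact: lct|exact: lc|exact: lc|exact: lct].
by rewrite (step M (leqnn M)) /t divff ?gt_eqF.
Qed.

End DegreeHomotopy.

(** * The test map of an almost-embedding *)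

Lemma cvg_row (R : realType) (T : Type) (F : set_system T) {FF : Filter F} d
    (f : T -> 'rV[R]_d) (v : 'rV[R]_d) :
  (forall j, (fun x => f x 0 j) @ F --> v 0 j) -> f @ F --> v.
Proof.
move=> fv A [P Pv PA].
have : \forall x \near F, forall j, P 0 j (f x 0 j).
  by apply: filter_forall => j; exact: (fv j _ (Pv 0 j)).
by apply: filterS => x Px; apply: PA => i j; rewrite ord1.
Qed.

Lemma coord_cvg (R : realType) (T : Type) (F : set_system T) {FF : Filter F} d
    (f : T -> 'rV[R]_d) (v : 'rV[R]_d) j :
  f @ F --> v -> (fun x => f x 0 j) @ F --> v 0 j.
Proof.
move=> fv A Av; apply: (fv [set w | A (w 0 j)]).
exists (fun i k => if k == j then A else setT).
  by move=> i k; rewrite ord1; case: eqP => [->//|_]; exact: filterT.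
by move=> w /(_ 0 j); rewrite eqxx.
Qed.

Lemma cvg_realization (R : realType) (V : finType) (K : simplicial_complex V)
    (T : Type) (F : set_system T) {FF : Filter F}
    (g : T -> realization R K) (x : realization R K) :
  (forall v, (fun t => (val (g t) : V -> R) v) @ F --> (val x : V -> R) v) ->
  g @ F --> x.
Proof.
move=> gx A [_ [[U oU <-] Ux] UA].
suff gX : (fun t => val (g t) : {ptws V -> R}) @ F --> (val x : {ptws V -> R}).
  have Un : nbhs (val x : {ptws V -> R}) U.
    by apply: open_nbhs_nbhs; split => //; move: Ux => /=; rewrite set_valE.
  have FU : F [set t | U (val (g t))] := gX _ Un.
  change (F [set t | A (g t)]).
  by apply: filterS FU => t Ut; apply: UA; rewrite /= set_valE.
apply/cvg_sup => v B [_ [[W oW <-] Wx] WB].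
have Wn : nbhs ((val x : V -> R) v) W by exact: open_nbhs_nbhs.
have FW : F [set t | W ((val (g t) : V -> R) v)] := gx v _ Wn.
change (F [set t | B (val (g t))]).
by apply: filterS FW => t Wt; exact: WB.
Qed.

Lemma realization_coord_continuous (R : realType) (V : finType)
    (K : simplicial_complex V) v :
  continuous (fun x : realization R K => (val x : V -> R) v).
Proof.
move=> x.
have vc : {for x, continuous
  (fun x : realization R K => val x : {ptws V -> R})}.
  by have := @initial_continuous _ {ptws V -> R}
    (@set_val _ (@realization_set R V K)) x; rewrite set_valE.
exact: (continuous_comp vc (@proj_continuous V (fun=> R) v _)).
Qed.

(* An odd map without zeros outside the origin whose positive and negative parts
   are supported on faces: an equivariant map from a sphere to the deleted join
   of [K] with itself. *)
Record deleted_join_chart (R : realType) (V : finType)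
    (K : simplicial_complex V)
    (n : nat) := DeletedJoinChart {
  chart :> 'rV[R]_n -> V -> R;
  chart_continuous : forall v, continuous (fun w => chart w v);
  chartN : forall w v, chart (- w) v = - chart w v;
  chart_eq0 : forall w, (forall v, chart w v = 0) -> w = 0;
  chart_face : forall w, [set v | 0 < chart w v]%SET \in faces K }.

Section TestMap.
Variables (R : realType) (V : finType) (K : simplicial_complex V) (d : nat).
Variable (psi : deleted_join_chart R K d.+1) (x0 : realization R K).
Local Notation W := 'rV[R]_d.+1.
Local Notation X := (realization R K).
Implicit Types (w : W).

Definition pos_part w v : R := Num.max (psi w v) 0.

Definition mass w : R := \sum_v pos_part w v.

(** The default [x0] is taken where the positive part is zero and cannot be normalized; [cutoff]
    vanishes there. *)
Definition to_realization w : X :=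
  match pselect (@realization_set R V K (fun v => pos_part w v / mass w)) with
  | left h => @exist {ptws V -> R} (fun x => x \in @realization_set R V K) _
    (mem_set h)
  | right _ => x0
  end.

Lemma pos_part_ge0 w v : 0 <= pos_part w v.
Proof. by rewrite le_max lexx orbT. Qed.

Lemma mass_ge0 w : 0 <= mass w.
Proof. by apply: sumr_ge0 => v _; exact: pos_part_ge0. Qed.

Lemma mass_eq0 w : mass w = 0 -> mass (- w) = 0 -> w = 0.
Proof.
move=> /eqP; rewrite psumr_eq0 => [/allP p0|v _]; last exact: pos_part_ge0.
move=> /eqP; rewrite psumr_eq0 => [/allP q0|v _]; last exact: pos_part_ge0.
apply: (@chart_eq0 _ _ _ _ psi) => v.
move: (p0 v (mem_index_enum v)) (q0 v (mem_index_enum v)) => /=.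
rewrite /pos_part chartN => /eqP p /eqP q; apply/eqP; rewrite eq_le.
have : psi w v <= 0 by rewrite -p le_max lexx.
have : - psi w v <= 0 by rewrite -q le_max lexx.
by rewrite oppr_le0 => -> ->.
Qed.

Lemma to_realizationE w v : 0 < mass w ->
  (val (to_realization w) : V -> R) v = pos_part w v / mass w.
Proof.
move=> w0; rewrite /to_realization; case: pselect => // -[]; split.
- by move=> u; rewrite divr_ge0 ?pos_part_ge0 ?ltW.
- by rewrite -mulr_suml divff ?gt_eqF.
exists [set v | 0 < psi w v]%SET; first exact: chart_face.
move=> u; rewrite inE -leNgt => u0.
by rewrite /pos_part max_r // mul0r.
Qed.

(** The deleted product of [K], on which [f x - f y] has no zero if [f] is an almost-embedding. *)
Definition separated : set (X * X) := [set xy | exists s t : {set V},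
  [/\ s \in faces K, t \in faces K, [disjoint s & t]%B,
      face_realization s xy.1 & face_realization t xy.2]].

Lemma to_realization_separated w : 0 < mass w -> 0 < mass (- w) ->
  separated (to_realization w, to_realization (- w)).
Proof.
move=> w0 w0'; exists [set v | 0 < psi w v]%SET, [set v | 0 < psi (- w) v]%SET.
split; [exact: chart_face|exact: chart_face| | |].
- rewrite disjoint_subset; apply/fintype.subsetP => v; rewrite !inE chartN.
  by rewrite oppr_gt0 -leNgt => /ltW.
- move=> v /=; rewrite inE -leNgt to_realizationE // => v0.
  by rewrite /pos_part max_r // mul0r.
- move=> v /=; rewrite inE -leNgt to_realizationE // => v0.
  by rewrite /pos_part max_r // mul0r.
Qed.

Lemma pos_part_continuous v : continuous (fun w => pos_part w v).
Proof.
move=> w; apply: (@continuous_max R W (fun w => psi w v) (fun=> 0) w).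
  exact: chart_continuous.
exact: cst_continuous.
Qed.

Lemma mass_continuous : continuous mass.
Proof.
by apply: (continuous_big (@add_continuous R)) => v _;
  exact: pos_part_continuous.
Qed.

Lemma to_realization_continuous w : 0 < mass w ->
  {for w, continuous to_realization}.
Proof.
move=> w0; apply: (@cvg_realization R V K W (nbhs w) (nbhs_filter w)) => v;
  rewrite to_realizationE //.
have mw : \forall w' \near w, 0 < mass w'.
  exact: (cvgr_gt _ (@mass_continuous w) _ w0).
apply: (cvg_trans (G := (pos_part w' v / mass w' @[w' --> w]))).
  by apply: near_eq_cvg; near=> w'; rewrite to_realizationE //; near: w'.
apply: (@cvgM R W (nbhs w) _ (fun w' => pos_part w' v)
  (fun w' => (mass w')^-1)); first exact: pos_part_continuous.
by apply: cvgV; [rewrite gt_eqF|exact: mass_continuous].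
Unshelve. all: by end_near. Qed.

(** Positive where the two masses are equal and nonzero, negative where exactly one of them
    vanishes. *)
Definition pre_cutoff w : R :=
  Num.min (mass w) (mass (- w)) *+ 2 - Num.max (mass w) (mass (- w)).

(* Vanishes where [mass w] or [mass (- w)] is close to [0], that is, where
   [to_realization w] or [to_realization (- w)] may be discontinuous. *)
Definition cutoff w : R := Num.max (pre_cutoff w) 0.

Definition test_map (Phi : X * X -> 'rV[R]_d) w : W :=
  \row_i match unlift ord0 i with
    | None => mass w - mass (- w)
    | Some j => cutoff w * Phi (to_realization w, to_realization (- w)) 0 j
    end.

Lemma opp_mass_continuous : continuous (fun w => mass (- w)).
Proof.
move=> w; apply: (@continuous_comp W W R -%R mass w);
  first exact: opp_continuous.
exact: mass_continuous.
Qed.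

Lemma pre_cutoff_continuous : continuous pre_cutoff.
Proof.
move=> w; apply: (@cvgB R R W (nbhs w) _
  (fun w => Num.min (mass w) (mass (- w)) *+ 2)
    (fun w => Num.max (mass w) (mass (- w)))).
  apply: (@cvgMn R R W (nbhs w) _ (fun w => Num.min (mass w) (mass (- w))));
    apply: (@continuous_min R W mass (fun w => mass (- w)) w).
    exact: mass_continuous.
  exact: opp_mass_continuous.
apply: (@continuous_max R W mass (fun w => mass (- w)) w).
  exact: mass_continuous.
exact: opp_mass_continuous.
Qed.

Lemma cutoff_continuous : continuous cutoff.
Proof.
move=> w; apply: (@continuous_max R W pre_cutoff (fun=> 0) w).
  exact: pre_cutoff_continuous.
exact: cst_continuous.
Qed.

Lemma cutoff_near0 w : w != 0 -> ~~ ((0 < mass w) && (0 < mass (- w))) ->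
  \forall w' \near w, cutoff w' = 0.
Proof.
move=> w0 mw; have pw : pre_cutoff w < 0.
  have : (0 < mass w) || (0 < mass (- w)).
    apply/negPn; rewrite negb_or -!leNgt; apply/negP => /andP[a b].
    by case/eqP: w0; apply: mass_eq0; apply/eqP; rewrite eq_le mass_ge0 andbT.
  have := mass_ge0 w; have := mass_ge0 (- w).
  move: mw; rewrite /pre_cutoff; case: (ltP 0 (mass w)) => a;
    case: (ltP 0 (mass (- w))) => b //= _ p q _.
    rewrite min_r ?max_l; lra.
  rewrite min_l ?max_r; lra.
have pw' : \forall w' \near w, pre_cutoff w' < 0.
  exact: (cvgr_lt _ (@pre_cutoff_continuous w) _ pw).
near=> w'; rewrite /cutoff max_r //; apply: ltW.
by near: w'.
Unshelve. all: by end_near. Qed.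

(** Where both masses are positive, the two points of the realization depend continuously on [w] and
    form a separated pair. Elsewhere the cutoff is zero in a whole neighbourhood. *)
Lemma test_map_within (Phi : R * (X * X) -> 'rV[R]_d) :
  {within `[0, 1] `*` separated, continuous Phi} ->
  {within (`[0, 1] : set R) `*` [set w : W | w != 0],
     continuous (fun p : R * W => test_map (fun z => Phi (p.1, z)) p.2)}.
Proof.
move=> Phic; apply/subspace_continuousP => -[t w] [/= t01 w0].
set D := `[0, 1] `*` _; set p := (t, w).
have snd_w : p'.2 @[p' --> within D (nbhs p)] --> w.
  by apply: cvg_within_filter; exact: cvg_snd.
have fst_t : p'.1 @[p' --> within D (nbhs p)] --> t.
  by apply: cvg_within_filter; exact: cvg_fst.
have lift_cvg (T : topologicalType) (f : W -> T) : {for w, continuous f} ->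
    f p'.2 @[p' --> within D (nbhs p)] --> f w.
  move=> fc; exact: (cvg_comp _ _ snd_w fc).
apply: cvg_row => j; rewrite !mxE.
under [X in X @ _ --> _]eq_fun do rewrite mxE.
case: unliftP => [j' _|_]; last first.
  apply: (lift_cvg _ (fun w => mass w - mass (- w))).
  apply: (@cvgB R R W (nbhs w) _ mass (fun w => mass (- w))).
    exact: mass_continuous.
  exact: opp_mass_continuous.
have [/andP[m1 m2]|mN] := boolP ((0 < mass w) && (0 < mass (- w))).
  apply: cvgM; first by apply: lift_cvg; exact: cutoff_continuous.
  apply: coord_cvg.
  pose g (p' : R * W) := (p'.1, (to_realization p'.2, to_realization (- p'.2))).
  have gp : g p' @[p' --> within D (nbhs p)] --> within
    (`[0, 1] `*` separated) (nbhs (g p)).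
    move=> U [/= [U1 U2] [U1t U2xy] UA].
    have G1 : \forall p' \near within D (nbhs p), U1 p'.1 := fst_t _ U1t.
    have ow : {for w, continuous (fun w => to_realization (- w))}.
      apply: (@continuous_comp W W X -%R to_realization w);
        first exact: opp_continuous.
      exact: to_realization_continuous.
    have G2 : \forall p' \near within D (nbhs p),
        U2 (to_realization p'.2, to_realization (- p'.2)).
      apply: (lift_cvg _ (fun w => (to_realization w, to_realization (- w))))
        U2xy.
      by apply: (@cvg_pair W X X (nbhs w) (nbhs (to_realization w))
        (nbhs (to_realization (- w))) _ _ _ to_realization
        (fun w => to_realization (- w))) => //;
        exact: to_realization_continuous.
    have G3 : \forall p' \near within D (nbhs p), 0 < mass p'.2 /\
      0 < mass (- p'.2).
      apply: (snd_w [set w' | 0 < mass w' /\ 0 < mass (- w')]).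
      apply: filterI.
        exact: (cvgr_gt _ (@mass_continuous w) _ m1).
      exact: (cvgr_gt _ (@opp_mass_continuous w) _ m2).
    have G4 : \forall p' \near within D (nbhs p), D p' by exact: withinT.
    have {}UA q : U1 q.1 -> U2 q.2 -> (`[0, 1] `*` separated) q -> U q.
      by move=> q1 q2; apply: UA.
    change (\forall p' \near within D (nbhs p), U (g p')).
    near=> p'; apply: UA => /=; [by near: p'|by near: p'|split => /=].
      have : D p' by near: p'.
      by case.
    have [] : 0 < mass p'.2 /\ 0 < mass (- p'.2) by near: p'.
    exact: to_realization_separated.
  apply: (cvg_comp _ _ gp).
  apply: ((subspace_continuousP _ _).1 Phic (g p)); split=> //=.
  exact: to_realization_separated.
have cut0 := cutoff_near0 w0 mN.
rewrite (nbhs_singleton cut0) mul0r.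
apply: (cvg_trans (G := (0 @[p' --> within D (nbhs p)]))); last exact: cvg_cst.
apply: near_eq_cvg.
have : \forall p' \near within D (nbhs p), cutoff p'.2 = 0 by exact: snd_w cut0.
by apply: filterS => p' ->; rewrite mul0r.
Unshelve. all: by end_near. Qed.
Lemma cutoff_gt0 w : 0 < cutoff w -> 0 < mass w /\ 0 < mass (- w).
Proof.
rewrite /cutoff /pre_cutoff lt_max ltxx orbF; have := mass_ge0 w;
  have := mass_ge0 (- w).
move: (mass w) (mass (- w)) => a b b0 a0; case: (leP a b) => ab; lra.
Qed.

Lemma cutoff_ge0 w : 0 <= cutoff w.
Proof. by rewrite le_max lexx orbT. Qed.

Lemma eq_test_map Phi Psi : {in separated, Phi =1 Psi} ->
  test_map Phi =1 test_map Psi.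
Proof.
move=> e w; apply/rowP => i; rewrite !mxE; case: unliftP => // j _.
have [c0|c0] := ltP 0 (cutoff w).
  by have [m m'] := cutoff_gt0 c0; rewrite e // inE;
    exact: to_realization_separated.
by rewrite (_ : cutoff w = 0) ?mul0r //; apply/eqP; rewrite eq_le c0 cutoff_ge0.
Qed.

(** At a zero the masses would be equal, hence positive, so that the cutoff would be positive and
    [Phi] would vanish at a separated pair. *)
Lemma test_map_neq0 Phi w : {in separated, forall z, Phi z != 0} -> w != 0 ->
  test_map Phi w != 0.
Proof.
move=> Phi0 w0; apply/eqP => t0.
have mm : mass w = mass (- w).
  by apply/eqP; rewrite -subr_eq0; have /rowP/(_ ord0) := t0;
    rewrite !mxE unlift_none => ->.
have m0 : 0 < mass w.
  rewrite lt_neqAle mass_ge0 andbT eq_sym; apply: contra w0 => /eqP m0.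
  by apply/eqP; apply: mass_eq0; rewrite -?mm.
have c0 : cutoff w != 0.
  by rewrite /cutoff /pre_cutoff -mm minxx maxxx mulr2n addrK max_l ?ltW //
    gt_eqF.
have m0' : 0 < mass (- w) by rewrite -mm.
have sep : (to_realization w, to_realization (- w)) \in separated.
  by rewrite inE; exact: to_realization_separated.
case/eqP: (Phi0 _ sep); apply/rowP => j; rewrite [RHS]mxE;
  have /rowP/(_ (lift ord0 j)) := t0.
by rewrite !mxE liftK => /eqP; rewrite mulf_eq0 (negPf c0) => /eqP.
Qed.

Lemma test_map_odd Phi w : (forall x y, Phi (y, x) = - Phi (x, y)) ->
  test_map Phi (- w) = - test_map Phi w.
Proof.
move=> Phi_odd; apply/rowP => i; rewrite !mxE; case: unliftP => [j _|_].
  rewrite (_ : cutoff (- w) = cutoff w);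
    first by rewrite opprK Phi_odd mxE mulrN.
  by rewrite /cutoff /pre_cutoff opprK minC [Num.max (mass _) _]maxC.
by rewrite opprK opprB.
Qed.

End TestMap.

Arguments separated {R V K}.

(** The difference of masses occupies coordinate 0, so the reflected coordinate moves to position 1,
    which is [lift ord0 ord0]. *)
Lemma test_map_reflection (R : realType) (V : finType)
    (K : simplicial_complex V)
    (d : nat) (psi : deleted_join_chart R K d.+2) (x0 : realization R K)
    (Phi : realization R K * realization R K -> 'rV[R]_d.+1) :
  test_map psi x0 (@reflection R d.+1 \o Phi) =1
  flip_coord (lift ord0 ord0) \o test_map psi x0 Phi.
Proof.
move=> w; apply/rowP => i; rewrite !mxE; case: unliftP => [j ->|->]; last first.
  by rewrite (negPf (neq_lift _ _)).
rewrite !mxE (inj_eq (@lift_inj _ _)) -val_eqE /=.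
by case: ifP => //; rewrite mulrN.
Qed.

Lemma cvg_sub_within (T U : topologicalType) (A : set T) (B : set U)
    (g : T -> U) x :
  {for x, continuous g} -> (forall y, A y -> B (g y)) ->
  g y @[y --> within A (nbhs x)] --> within B (nbhs (g x)).
Proof.
move=> gc AB U' U'x; have near_x : nbhs x [set y | B (g y) -> U' (g y)] :=
  gc _ U'x.
change (nbhs x [set y | A y -> U' (g y)]).
by apply: filterS near_x => y gy Ay; apply: gy; exact: AB.
Qed.

Lemma within_continuous_comp (T U Z : topologicalType) (A : set T) (B : set U)
    (g : T -> U) (f : U -> Z) :
  {within B, continuous f} -> continuous g -> (forall y, A y -> B (g y)) ->
  {within A, continuous (f \o g)}.
Proof.
move=> fc gc AB; apply/subspace_continuousP => x Ax.
apply: (cvg_comp _ _ (cvg_sub_within (gc x) AB)).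
by apply: ((subspace_continuousP _ _).1 fc); exact: AB.
Qed.

Lemma pair_continuous (T U Z : topologicalType) (f : T -> U) (g : T -> Z) :
  continuous f -> continuous g -> continuous (fun x => (f x, g x)).
Proof.
move=> fc gc x.
apply: (@cvg_pair T U Z (nbhs x) (nbhs (f x)) (nbhs (g x)) _ _ _ f g).
  exact: fc.
exact: gc.
Qed.

Lemma sub_row_continuous (R : realType) d (T : topologicalType)
    (f g : T -> 'rV[R]_d) :
  continuous f -> continuous g -> continuous (fun x => f x - g x).
Proof.
by move=> fc gc x; apply: (@cvgB _ _ T (nbhs x) _ f g); [exact: fc|exact: gc].
Qed.

Lemma scale_row_continuous (R : realType) d (T : topologicalType)
    (a : T -> R) (f : T -> 'rV[R]_d) :
  continuous a -> continuous f -> continuous (fun x => a x *: f x).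
Proof.
by move=> ac fc x; apply: (@cvgZ _ _ T (nbhs x) _ a f); [exact: ac|exact: fc].
Qed.

(** * Mirror images and the sign of the degree *)

Section NoMirror.
Variables (R : realType) (V : finType) (K : simplicial_complex V) (d : nat).
Variable (psi : deleted_join_chart R K d.+2) (x0 : realization R K).
Local Notation X := (realization R K).
Local Notation S := (@shell R d.+1).

Lemma almost_embedding_separated (f : X -> 'rV[R]_d.+1) x y :
  almost_embedding f -> separated (x, y) -> f x != f y.
Proof.
move=> [_ fd] [s [t [sK tK st xs yt]]]; apply/eqP => fxy.
suff : (f @` face_realization s `&` f @` face_realization t) (f x).
  by rewrite fd.
by split; [exists x|exists y].
Qed.

Lemma test_map_homotopy (Phi : R * (X * X) -> 'rV[R]_d.+1) :
  {within (`[0, 1] : set R) `*` (separated : set (X * X)), continuous Phi} ->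
  (forall t, 0 <= t <= 1 -> {in separated, forall z, Phi (t, z) != 0}) ->
  exists N0, forall N, (N0 <= N)%N ->
    label_compatible (mesh R d.+1 N)
      (test_map psi x0 (fun z => Phi (0, z)))
        (test_map psi x0 (fun z => Phi (0, z))) /\
    degree N (test_map psi x0 (fun z => Phi (0, z))) =
    degree N (test_map psi x0 (fun z => Phi (1, z))).
Proof.
move=> Phic Phi0.
have [||N0 N0P] := @degree_homotopy R d.+1
  (fun p => test_map psi x0 (fun z => Phi (p.1, z)) p.2).
- have sub : (`[0, 1] : set R) `*` S `<=`
    (`[0, 1] : set R) `*` [set w : 'rV[R]_d.+2 | w != 0].
    move=> p [p1 p2]; split => //=; exact: shell_neq0.
  exact: (continuous_subspaceW sub (test_map_within Phic)).
- by move=> t x t01 xS; apply: test_map_neq0; [exact: Phi0|exact: shell_neq0].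
exists N0 => N /N0P[lc e]; split; last exact: e.
by apply: (lc 0); rewrite lexx ler01.
Qed.

Lemma degree_eq_test_map N Phi Psi : {in separated, Phi =1 Psi} ->
  degree N (test_map psi x0 Phi) = degree N (test_map psi x0 Psi).
Proof. by move=> e; apply: eq_degree => w _; exact: eq_test_map. Qed.

Lemma not_homotopic_mirror_image (f g : X -> 'rV[R]_d.+1) :
  almost_embedding f -> mirror_image f g -> ~ almost_embedding_homotopic f g.
Proof.
move=> fE [h [[hc [hi [_ hK _]]] [P [Pc P0 P1 Pn0]] ->]] [H [Hc H0 H1 HE]].
have [fc _] := fE.
(* Three homotopies in succession: from [f x - f y] to [h (f x) - h (f y)], then to
   [h (f x - f y) - h 0], then to the reflection of [f x - f y]. *)
pose Phi1 (p : R * (X * X)) := H (p.1, p.2.1) - H (p.1, p.2.2).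
pose Phi2 (p : R * (X * X)) :=
  h (f p.2.1 - p.1 *: f p.2.2) - h (f p.2.2 - p.1 *: f p.2.2).
pose Phi3 (p : R * (X * X)) := P (p.1, f p.2.1 - f p.2.2).
have fst_c : continuous (fun p : R * (X * X) => p.1) by move=> p;
  exact: cvg_fst.
have x_c : continuous (fun p : R * (X * X) => p.2.1).
  by move=> p; apply: continuous_comp; [exact: cvg_snd|exact: cvg_fst].
have y_c : continuous (fun p : R * (X * X) => p.2.2).
  by move=> p; apply: continuous_comp; [exact: cvg_snd|exact: cvg_snd].
have fx_c : continuous (fun p : R * (X * X) => f p.2.1).
  by move=> p; apply: continuous_comp; [exact: x_c|exact: fc].
have fy_c : continuous (fun p : R * (X * X) => f p.2.2).
  by move=> p; apply: continuous_comp; [exact: y_c|exact: fc].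
have [||N1 N1P] := @test_map_homotopy Phi1.
- have Hx_c : {within `[0, 1] `*` separated,
    continuous (H \o (fun p : R * (X * X) => (p.1, p.2.1)))}.
    apply: (within_continuous_comp Hc); last by move=> p [].
    by apply: pair_continuous; [exact: fst_c|exact: x_c].
  have Hy_c : {within `[0, 1] `*` separated,
    continuous (H \o (fun p : R * (X * X) => (p.1, p.2.2)))}.
    apply: (within_continuous_comp Hc); last by move=> p [].
    by apply: pair_continuous; [exact: fst_c|exact: y_c].
  by move=> p; apply: cvgB; [exact: Hx_c|exact: Hy_c].
- move=> t t01 [x y]; rewrite inE => xy; rewrite subr_eq0.
  exact: (almost_embedding_separated (HE t t01)).
have [||N2 N2P] := @test_map_homotopy Phi2.
- have tfy_c : continuous (fun p : R * (X * X) => p.1 *: f p.2.2).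
    exact: scale_row_continuous.
  apply: continuous_subspaceT; apply: sub_row_continuous => p.
    apply: (@continuous_comp _ _ _
      (fun p : R * (X * X) => f p.2.1 - p.1 *: f p.2.2) h); last exact: hc.
    by apply: sub_row_continuous; [exact: fx_c|exact: tfy_c].
  apply: (@continuous_comp _ _ _
    (fun p : R * (X * X) => f p.2.2 - p.1 *: f p.2.2) h); last exact: hc.
  by apply: sub_row_continuous; [exact: fy_c|exact: tfy_c].
- move=> t t01 [x y]; rewrite inE => xy;
    rewrite subr_eq0 /= (inj_eq (can_inj hK)).
  by rewrite (inj_eq (addIr _)); exact: almost_embedding_separated.
have [||N3 N3P] := @test_map_homotopy Phi3.
- apply: (@within_continuous_comp _ _ _ _ _
    (fun p : R * (X * X) => (p.1, f p.2.1 - f p.2.2)) _ Pc).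
    apply: pair_continuous; first exact: fst_c.
    by apply: sub_row_continuous; [exact: fx_c|exact: fy_c].
  move=> [t [x y]] [/= t01 xy]; split => //=; rewrite subr_eq0.
  exact: almost_embedding_separated.
- move=> t t01 [x y]; rewrite inE => xy; apply: Pn0 => //=; rewrite subr_eq0.
  exact: almost_embedding_separated.
(* One subdivision fine enough for all three homotopies. *)
have [N [NN1 NN2 NN3]] : exists N, [/\ N1 <= N, N2 <= N & N3 <= N]%N.
  by exists (maxn N1 (maxn N2 N3)); rewrite !leq_max !leqnn !orbT.
have [lc e1] := N1P N NN1.
have [_ e2] := N2P N NN2.
have [_ e3] := N3P N NN3.
pose F := test_map psi x0 (fun z => Phi1 (0, z)).
have Fneq0 : {in S, forall x, F x != 0}.
  move=> w; rewrite inE => wS; apply: test_map_neq0; last exact: shell_neq0.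
  move=> [x y]; rewrite inE => xy; rewrite subr_eq0 /= !H0.
  exact: almost_embedding_separated.
have odd1 : (degree N F)%:~R = 1 :> 'F_2.
  apply: degree_odd; [exact: Fneq0| |exact: lc].
  by move=> w _; apply: test_map_odd => x y; rewrite /Phi1 opprB.
have : degree N F = - degree N F.
  rewrite -[RHS](degree_flip (lift ord0 ord0) Fneq0 lc) {1}/F e1.
  transitivity (degree N (test_map psi x0 (fun z => Phi2 (0, z)))).
    by apply: degree_eq_test_map => -[x y] _;
      rewrite /Phi1 /Phi2 /= !H1 scale0r !subr0.
  rewrite e2; transitivity (degree N (test_map psi x0 (fun z => Phi3 (0, z)))).
    apply: degree_eq_test_map => -[x y]; rewrite inE => xy.
    have ne : f x - f y != 0 by rewrite subr_eq0;
      exact: almost_embedding_separated.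
    rewrite /Phi2 /Phi3 /=.
    rewrite (P0 _ ne).
    rewrite scale1r.
    by rewrite [f y - f y]subrr.
  rewrite e3.
  transitivity (degree N (test_map psi x0
    (@reflection R d.+1 \o (fun z => Phi1 (0, z))))).
    apply: degree_eq_test_map => -[x y]; rewrite inE => xy.
    have ne : f x - f y != 0 by rewrite subr_eq0;
      exact: almost_embedding_separated.
    by rewrite /Phi3 /Phi1 /= !H0 (P1 _ ne).
  by apply: eq_degree => w _; exact: test_map_reflection.
move/eqP; rewrite -addr_eq0 -mulr2n mulrn_eq0 /= => /eqP F0.
by move: odd1; rewrite F0 => /(congr1 val).
Qed.

End NoMirror.

(** * Medians *)

Section Median.
Variables (R : realType) (V : finType) (B : {set V}) (c : nat).
Hypothesis cardB : #|B| = (c + c).+1.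
Implicit Types (z : V -> R) (m e : R).

(** Symmetric under negation, and satisfied by only one [m] because [#|B|] is odd; this gives
    [medianN]. *)
Definition is_median z m : Prop :=
  (#|[set v in B | (z v < m)%R]%SET| <= c)%N /\
  (#|[set v in B | (m < z v)%R]%SET| <= c)%N.

Definition median z : R := nth 0 (sort <=%R [seq z v | v <- enum B]) c.

Lemma medianP z : is_median z (median z).
Proof.
set s := sort <=%R [seq z v | v <- enum B]; set m := median z.
have ss : size s = (c + c).+1 by rewrite size_sort size_map -cardE.
have sorted_s : sorted <=%R s by apply: sort_sorted; exact: le_total.
have cs : (c < size s)%N by rewrite ss ltnS leq_addr.
have countE (P : pred R) : #|[set v in B | P (z v)]%SET| = count P s.
  rewrite /s count_sort count_map -size_filter.
  rewrite -(card_uniqP (filter_uniq _ (enum_uniq (mem B)))).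
  by apply: eq_card => v; rewrite mem_filter mem_enum inE andbC.
have nth_le i j : (i <= j)%N -> (j < size s)%N -> nth 0 s i <= nth 0 s j.
  move=> ij js; apply: (sorted_leq_nth le_trans le_refl 0 sorted_s) => //.
  by rewrite inE (leq_ltn_trans ij).
split.
  rewrite (countE (fun x => x < m)) -(cat_take_drop c s) count_cat.
  rewrite (_ : count _ (drop c s) = 0%N).
    by rewrite addn0 (leq_trans (count_size _ _)) // size_take_min geq_minl.
  apply/eqP; rewrite eqn0Ngt -has_count; apply/negP => /(has_nthP 0)[i].
  rewrite size_drop nth_drop => ic; apply/negP; rewrite -leNgt.
  by apply: nth_le; rewrite ?leq_addr // -ltn_subRL.
rewrite (countE (fun x => m < x)) -(cat_take_drop c.+1 s) count_cat.
rewrite (_ : count _ (take c.+1 s) = 0%N).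
  by rewrite add0n (leq_trans (count_size _ _)) // size_drop ss subSS addKn.
apply/eqP; rewrite eqn0Ngt -has_count; apply/negP => /(has_nthP 0)[i].
rewrite size_take_min leq_min => /andP[ic _]; rewrite nth_take //; apply/negP.
by rewrite -leNgt; apply: nth_le.
Qed.

(** If [m' + e < m], each element of [B] satisfies [z v < m] or [m' < z' v], which leaves room for
    only [c + c] elements. *)
Lemma is_median_le z z' m m' e : is_median z m -> is_median z' m' ->
  (forall v, z v <= z' v + e) -> m <= m' + e.
Proof.
move=> [zm _] [_ zm'] zz'; rewrite leNgt; apply/negP => mm'.
have : (#|B| <= c + c)%N.
  apply: leq_trans (leq_add zm zm').
  apply: leq_trans (leq_card_setU _ _);
    apply/subset_leq_card/fintype.subsetP => v vB.
  rewrite !inE vB /=; case: (leP (z' v) m') => [z'm|_]; last by rewrite orbT.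
  by rewrite (le_lt_trans (zz' v)) // (le_lt_trans _ mm') // lerD2r.
by rewrite cardB ltnn.
Qed.

Lemma is_median_unique z m m' : is_median z m -> is_median z m' -> m = m'.
Proof.
move=> mz mz'; apply/eqP; rewrite eq_le -{1}[m']addr0 -{2}[m]addr0.
by apply/andP; split; [apply: (is_median_le mz mz')|apply:
  (is_median_le mz' mz)]
  => v; rewrite addr0.
Qed.

Lemma medianN z : median (fun v => - z v) = - median z.
Proof.
apply: is_median_unique (medianP _) _; have [lo hi] := medianP z; split.
  apply: leq_trans hi; rewrite leq_eqVlt; apply/orP; left; apply/eqP.
  by apply: eq_card => v; rewrite !inE ltrN2.
apply: leq_trans lo; rewrite leq_eqVlt; apply/orP; left; apply/eqP.
by apply: eq_card => v; rewrite !inE ltrN2.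
Qed.

Lemma median_dist z z' e : (forall v, `|z v - z' v| <= e) ->
  `|median z - median z'| <= e.
Proof.
move=> zz'.
have le1 : median z <= median z' + e.
  apply: is_median_le (medianP z) (medianP z') _ => v; rewrite -lerBlDl.
  exact: ler_normlW.
have le2 : median z' <= median z + e.
  apply: is_median_le (medianP z') (medianP z) _ => v; rewrite -lerBlDl.
  by have := zz' v; rewrite distrC => /ler_normlW.
by rewrite ler_norml; lra.
Qed.

End Median.

Section MedianChart.
Variables (R : realType) (V I : finType) (K : simplicial_complex V) (n c : nat).
Variables (blk : V -> I) (idx : V -> option 'I_n).
Hypothesis card_blk : forall i, #|[set v | blk v == i]%SET| = (c + c).+1.
Hypothesis idx_surj : forall j, exists v, idx v = Some j.
Hypothesis blk_base : forall i, exists2 v, blk v = i & idx v = None.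
Hypothesis blk_face : forall s : {set V},
  (forall i, (#|[set v in s | blk v == i]%SET| <= c)%N) -> s \in faces K.

Definition extend_coord (w : 'rV[R]_n) (v : V) : R :=
  if idx v is Some j then w 0 j else 0.

(* After subtracting the median of each block, at most [c] of the [2 c + 1]
   coordinates of a block are positive, and at most [c] are negative. *)
Definition median_chart (w : 'rV[R]_n) (v : V) : R :=
  extend_coord w v - median [set u | blk u == blk v]%SET c (extend_coord w).

Lemma median_chart_continuous v : continuous (fun w => median_chart w v).
Proof.
have ext_dist w w' u : `|extend_coord w u - extend_coord w' u| <= `|w - w'|.
  rewrite /extend_coord; case: (idx u) => [j|]; last by rewrite subrr normr0.
  by have := coord_le_norm (w - w') j; rewrite !mxE.
have lip (f : 'rV[R]_n -> R) :
  (forall w w', `|f w - f w'| <= `|w - w'|) -> continuous f.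
  move=> fl w; apply/(@cvgrPdist_lt _ _ _ (nbhs w) (nbhs_filter w)) => e e0;
    near=> w'.
  apply: le_lt_trans (fl w w') _; near: w'.
  by apply: (@cvgr_dist_lt _ _ _ (nbhs w) _ id w).
move=> w; apply: (@cvgB _ _ _ (nbhs w) _ (fun w => extend_coord w v)
  (fun w => median [set u | blk u == blk v]%SET c (extend_coord w))).
  by apply: lip => w1 w2; exact: ext_dist.
by apply: lip => w1 w2; apply: median_dist.
Unshelve. all: by end_near. Qed.

Lemma median_chartN w v : median_chart (- w) v = - median_chart w v.
Proof.
rewrite /median_chart opprD -(medianN (card_blk (blk v)) (extend_coord w)).
have extN u : extend_coord (- w) u = - extend_coord w u.
  by rewrite /extend_coord; case: (idx u) => [j|]; rewrite ?mxE ?oppr0.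
have -> : extend_coord (- w) = fun u => - extend_coord w u by apply/funext.
by [].
Qed.

(** The base vertex of a block carries the coordinate 0, so the median of the block is 0, and with
    it every coordinate of the block. *)
Lemma median_chart_eq0 w : (forall v, median_chart w v = 0) -> w = 0.
Proof.
move=> w0; apply/rowP => j; rewrite mxE; have [v vj] := idx_surj j.
have [u uv u0] := blk_base (blk v).
have := w0 v; have := w0 u; rewrite /median_chart uv /extend_coord u0 vj.
by move=> /eqP; rewrite sub0r oppr_eq0 => /eqP ->; rewrite subr0.
Qed.

Lemma median_chart_face w : [set v | 0 < median_chart w v]%SET \in faces K.
Proof.
apply: blk_face => i; have [_] := medianP (card_blk i) (extend_coord w).
apply: leq_trans; apply/subset_leq_card/fintype.subsetP => v.
by rewrite !inE => /andP[v0 /eqP vi]; rewrite vi eqxx /= -subr_gt0 -vi.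
Qed.

Definition median_deleted_join_chart : deleted_join_chart R K n :=
  DeletedJoinChart median_chart_continuous median_chartN median_chart_eq0
    median_chart_face.

End MedianChart.

Section Charts.
Variables (R : realType) (k : nat).

(** One block with [c = k.+1]: at most [k.+1] vertices are positive, which is a face of the
    [k]-skeleton. Vertex 0 is the base. *)
Lemma skeleton_chart : deleted_join_chart R (skeleton k (simplex (2 * k + 2)))
    (2 * k).+2.
Proof.
pose idx (v : 'I_(2 * k + 2).+1) : option 'I_(2 * k).+2 :=
  if v == ord0 then None else Some (inord v.-1).
apply: (@median_deleted_join_chart _ _ unit _ _ k.+1 (fun=> tt) idx).
- move=> i; rewrite (_ : [set _ | _]%SET = [set: 'I_(2 * k + 2).+1]%SET).
    by rewrite cardsT card_ord; lia.
  by apply/setP => v; rewrite !inE; case: i.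
- move=> j; exists (inord j.+1); have jlt := ltn_ord j.
  have jE : @inord (2 * k + 2) j.+1 = j.+1 :> nat by rewrite inordK //; lia.
  rewrite /idx -val_eqE /= jE /=; congr Some; apply: val_inj.
  by rewrite /= inordK.
- by move=> []; exists ord0 => //; rewrite /idx eqxx.
- move=> s /(_ tt); rewrite !inE /=; apply: leq_trans.
  by apply/subset_leq_card/fintype.subsetP => v vs; rewrite !inE vs.
Qed.

(** Blocks of three points with [c = 1]. Point 0 of block [i] is its base; points 1 and 2 carry the
    coordinates [2 * i] and [2 * i + 1]. *)
Lemma join_chart : deleted_join_chart R (join_power (points 3) k.+1) (2 * k).+2.
Proof.
pose idx (v : 'I_k.+1 * 'I_3) : option 'I_(2 * k).+2 :=
  if v.2 == ord0 then None else Some (inord (2 * v.1 + v.2.-1)).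
apply: (@median_deleted_join_chart _ _ 'I_k.+1 _ _ 1 fst idx).
- move=> i; rewrite (_ : [set _ | _]%SET =
    finset.setX [set i]%SET [set: 'I_3]%SET).
    by rewrite cardsX cards1 cardsT card_ord.
  by apply/setP => -[a b]; rewrite !inE /= andbT.
- move=> j; have jlt := ltn_ord j; exists (inord j./2, inord (odd j).+1).
  have j1 : @inord k j./2 = j./2 :> nat by rewrite inordK //; lia.
  have j2 : @inord 2 (odd j).+1 = (odd j).+1 :> nat by rewrite inordK //; lia.
  rewrite /idx /= -val_eqE /= j2 /= j1; congr Some; apply: val_inj => /=.
  by rewrite inordK //; lia.
- by move=> i; exists (i, ord0) => //; rewrite /idx eqxx.
- move=> s sB; rewrite inE; apply/forallP => i; rewrite inE.
  apply: leq_trans (sB i); rewrite -(card_imset _ (f := fun a => (i, a))) =>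
    [|a b []//].
  apply/subset_leq_card/fintype.subsetP => _ /imsetP[a ia ->].
  by rewrite !inE in ia *; rewrite ia eqxx.
Qed.

End Charts.

(** * The moment curve *)

Section MomentCurve.
Variables (R : realType) (V : finType) (K : simplicial_complex V) (d : nat).
Hypothesis K_general : forall s t : {set V}, s \in faces K -> t \in faces K ->
  [disjoint s & t]%B -> (#|s| + #|t| <= d.+1)%N.

Definition moment_parameter (v : V) : R := (enum_rank v : nat)%:R.

(** The affine extension of a placement of the vertices on the moment curve. It provides the
    almost-embedding that makes the coindex at least 0. *)
Definition moment_map (x : realization R K) : 'rV[R]_d :=
  \row_(j < d) \sum_v (val x : V -> R) v * moment_parameter v ^+ j.+1.

Lemma moment_map_continuous : continuous moment_map.
Proof.
move=> x; apply: (@cvg_row R _ (nbhs x) (nbhs_filter x)) => j; rewrite mxE.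
under [X in X @ _ --> _]eq_fun do rewrite mxE.
apply: (@cvg_big _ _ _ _ _ (@add_continuous R)) => v _.
apply: (@cvgMr_tmp _ _ (nbhs x)).
exact: realization_coord_continuous.
Qed.

Lemma moment_parameter_inj : injective moment_parameter.
Proof.
by move=> u v /eqP; rewrite /moment_parameter eqr_nat =>
  /eqP/val_inj/enum_rank_inj.
Qed.

(** Vandermonde independence: [u] is paired with the polynomial [p] of degree at most [d] whose
    roots are the parameters of [S] without [v0], which isolates [u v0]. *)
Lemma vanishing_moments (S : {set V}) (u : V -> R) : (#|S| <= d.+1)%N ->
  (forall v, v \notin S -> u v = 0) ->
  (forall i, (i < d.+1)%N -> \sum_v u v * moment_parameter v ^+ i = 0) ->
  forall v, u v = 0.
Proof.
move=> Sd uS moments v0; have [v0S|/uS//] := boolP (v0 \in S).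
pose p := \prod_(a <- [seq moment_parameter v | v <- enum (S :\ v0)%SET])
  ('X - a%:P).
have size_p : (size p <= d.+1)%N.
  rewrite size_prod_XsubC size_map -cardE (leq_trans _ Sd) //.
  by rewrite [leqRHS](cardsD1 v0) v0S.
have : \sum_v u v * p.[moment_parameter v] = 0.
  under eq_bigr do rewrite (horner_coef_wide _ size_p) big_distrr /=.
  rewrite exchange_big big1 // => i _.
  under eq_bigr do rewrite mulrCA.
  by rewrite -big_distrr /= moments ?mulr0.
rewrite (bigD1 v0) //= big1 ?addr0 => [/eqP|v vv0].
  rewrite mulf_eq0 -rootE root_prod_XsubC => /orP[/eqP//|/mapP[v]].
  by rewrite mem_enum !inE => /andP[vv0 _] /moment_parameter_inj v0v;
    rewrite v0v eqxx in vv0.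
have [vS|/uS ->] := boolP (v \in S); last by rewrite mul0r.
suff /rootP -> : root p (moment_parameter v) by rewrite mulr0.
by rewrite root_prod_XsubC; apply: map_f; rewrite mem_enum !inE vv0.
Qed.

(** If two points have the same image, their difference has vanishing moments of orders 0 to [d],
    order 0 because both coordinate sums are 1. So the points coincide, which disjoint supports
    forbid. *)
Lemma moment_map_almost_embedding : almost_embedding moment_map.
Proof.
split; first exact: moment_map_continuous.
move=> s t sK tK st; rewrite -subset0 => _ [[x xs <-] [y yt yx]].
pose u v := (val x : V -> R) v - (val y : V -> R) v.
have [_ x1 _] := set_mem (valP x); have [_ y1 _] := set_mem (valP y).
have u0 : forall v, u v = 0.
  apply: (@vanishing_moments (s :|: t)%SET).
  - by rewrite cardsU disjoint_setI0 // cards0 subn0 K_general.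
  - move=> v; rewrite inE negb_or => /andP[vs vt].
    by rewrite /u xs // yt // subrr.
  - move=> [_|i id].
      by under eq_bigr do rewrite expr0 mulr1; rewrite sumrB x1 y1 subrr.
    have /rowP/(_ (Ordinal (id : (i < d)%N))) := yx; rewrite !mxE /= => e.
    by under eq_bigr do rewrite mulrBl; rewrite sumrB e subrr.
have : \sum_v (val x : V -> R) v = 0.
  apply: big1 => v _; have [vt|vt] := boolP (v \in t).
    by rewrite xs // (disjointFl st vt).
  by have := u0 v; rewrite /u (yt v vt) subr0.
by rewrite x1 => /eqP; rewrite oner_eq0.
Qed.

End MomentCurve.

(** * Topology of the geometric realization *)

Section RealizationTopology.
Variables (R : realType) (V : finType) (K : simplicial_complex V).
Local Notation X := (realization R K).
Local Notation T := {ptws V -> R}.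

Lemma realization_set_closed : closed (@realization_set R V K).
Proof.
have pc v : continuous (fun x : T => x v) := @proj_continuous V (fun=> R) v.
have -> : @realization_set R V K =
    (\bigcap_v [set x : T | 0 <= x v]) `&` [set x : T | \sum_v x v = 1] `&`
    (\bigcup_(s in [set s | s \in faces K]) \bigcap_(v in [set v | v \notin s])
       [set x : T | x v = 0]).
  apply/seteqP; split=> [x [x0 x1 [s sK xs]]|x [[x0 x1] [s sK xs]]].
    split; last by exists s.
    by split; [move=> v _; exact: x0|exact: x1].
  split; [move=> v; exact: x0|exact: x1|exists s => //].
apply: closedI; [apply: closedI|].
- apply: closed_bigI => v _.
  exact: (closed_comp (fun x _ => pc v x) (@closed_ge R 0)).
- apply: (closed_comp (f := fun x : T => \sum_v x v) _ (@closed_eq R 1)) => x _.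
  by apply: (continuous_big (@add_continuous R)) => v _; exact: pc.
apply: closed_bigcup => [|s _]; first exact: finite_finset.
apply: closed_bigI => v _.
exact: (closed_comp (fun x _ => pc v x) (@closed_eq R 0)).
Qed.

Lemma realization_set_compact : compact (@realization_set R V K).
Proof.
have cube_compact : compact
  [set x : T | forall v, (`[0, 1]%classic : set R) (x v)].
  by apply: (@tychonoff V (fun=> R) (fun=> `[0, 1]%classic)) => v;
    exact: segment_compact.
apply: (subclosed_compact realization_set_closed cube_compact).
move=> x [x0 x1 _] v /=; rewrite in_itv /= x0 -x1 (bigD1 v) //= lerDl.
by apply: sumr_ge0.
Qed.

Lemma realization_compact : compact [set: X].
Proof.
have [[x0 _]|X0] := pselect (exists x0 : X, True); last first.
  by move=> F FF _; case: X0; have [x _] := filter_ex (@filterT _ F _);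
    exists x.
(* A left inverse of [val] up to the default [x0], shown to be continuous within the realization
   set. *)
pose g (y : T) : X := insubd x0 y.
have gE y : @realization_set R V K y -> val (g y) = y.
  by move=> Ay; rewrite val_insubd (mem_set Ay).
have -> : [set: X] = g @` @realization_set R V K.
  apply/seteqP; split=> // x _; exists (val x); first exact: (set_mem (valP x)).
  by apply: val_inj; rewrite gE //; exact: (set_mem (valP x)).
apply: continuous_compact realization_set_compact.
apply/subspace_continuousP => y Ay; apply: cvg_realization => v; rewrite gE //.
apply: (cvg_trans (G := (z : V -> R) v
  @[z --> within (@realization_set R V K) (nbhs (y : T))])).
  apply: near_eq_cvg; near=> z; rewrite gE //; near: z; exact: withinT.
by apply: cvg_within_filter; exact: (@proj_continuous V (fun=> R) v).
Unshelve. all: by end_near. Qed.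

Lemma realization_hausdorff : hausdorff_space X.
Proof.
rewrite open_hausdorff => x y xy.
have [v xyv] : exists v, (val x : V -> R) v != (val y : V -> R) v.
  apply/not_existsP => e; case/eqP: xy; apply: val_inj; apply/funext => v.
  by apply/eqP/negPn/negP; exact: e.
have := @Rhausdorff R; rewrite open_hausdorff => /(_ _ _ xyv).
move=> [[A B] /= [xA yB] [oA oB AB]].
have pc := @realization_coord_continuous R V K v.
exists ((fun z : X => (val z : V -> R) v) @^-1` A,
  (fun z : X => (val z : V -> R) v) @^-1` B).
  by rewrite /= !inE; split; exact: set_mem.
split; [by apply: open_comp => // z _; exact: pc|by apply: open_comp => // z _;
  exact: pc|].
apply/eqP; rewrite -subset0 => z [/= zA zB].
suff : (A `&` B) ((val z : V -> R) v) by rewrite (eqP AB).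
by split; [exact: zA|exact: zB].
Qed.

(** With the Hausdorff property, this allows a path in the compact-open topology to be uncurried
    into a jointly continuous homotopy. *)
Lemma realization_locally_compact : locally_compact [set: X].
Proof.
move=> x _; exists [set: X]; first by rewrite withinET; exact: filterT.
by split; [exact: realization_compact|exact: closedT].
Qed.

End RealizationTopology.

(** * The coindex *)

Lemma set_type_continuous (T U : topologicalType) (A : set U) (f : T -> A) :
  continuous (fun x => val (f x)) -> continuous f.
Proof.
move=> fc; apply/continuousP => _ [C oC <-].
rewrite (_ : f @^-1` _ = (fun x => val (f x)) @^-1` C);
  first by move/continuousP: fc; apply.
by apply/seteqP; split => x /=; rewrite set_valE.
Qed.

Lemma val_continuous (U : topologicalType) (A : set U) :
    continuous (val : A -> U).
Proof. by have := @initial_continuous A U set_val; rewrite set_valE. Qed.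

Lemma mirror_image_reflection (R : realType) d (T : Type) (f : T -> 'rV[R]_d) :
  mirror_image f (@reflection R d \o f).
Proof.
exists (@reflection R d); split => //.
  split; first exact: reflection_continuous.
  exists (@reflection R d); split; [exact: reflection_continuous| |];
    exact: reflectionK.
have r0 : @reflection R d 0 = 0.
  by apply/rowP => j; rewrite !mxE oppr0 if_same.
exists (fun p => @reflection R d p.2); split.
- apply: continuous_subspaceT => p.
  by apply: continuous_comp; [exact: cvg_snd|exact: reflection_continuous].
- by move=> x _; rewrite r0 subr0.
- by [].
- move=> t x _; apply: contra => /eqP /= x0.
  by rewrite -[x]reflectionK x0 r0.
Qed.

Section Meridian.
Variables (R : realType) (m : nat).

(** Half of a great circle, from the first basis vector to its antipode, with first coordinate
    affine in [t]. *)
Definition meridian_vector (t : R) : 'rV[R]_m.+2 :=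
  \row_j (if val j == 0%N then 1 - t *+ 2
          else if val j == 1%N then Num.sqrt (1 - (1 - t *+ 2) ^+ 2) else 0).

(** Extends the path to the whole line, so that its continuity needs no subspace topology. *)
Definition unit_clamp (t : R) : R := Num.max 0 (Num.min 1 t).

Lemma unit_clamp_id t : 0 <= t <= 1 -> unit_clamp t = t.
Proof. by move=> /andP[t0 t1]; rewrite /unit_clamp min_r // max_r. Qed.

Lemma unit_clamp_itv t : 0 <= unit_clamp t <= 1.
Proof. by rewrite le_max lexx /= ge_max ler01 ge_min lexx. Qed.

Lemma meridian_sphere t : sphere_set (meridian_vector (unit_clamp t)).
Proof.
have /andP[c0 c1] := unit_clamp_itv t; set c := unit_clamp t in c0 c1 *.
rewrite /sphere_set /= !big_ord_recl big1 => [|j _];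
  last by rewrite mxE /= expr0n.
rewrite !mxE /= sqr_sqrtr; first by ring.
rewrite (_ : 1 - _ = c * (1 - c) *+ 4); last by ring.
by rewrite mulrn_wge0 // mulr_ge0 // subr_ge0.
Qed.

Definition meridian (t : R) : sphere R m.+2 :=
  exist (fun x => x \in @sphere_set R m.+2) _ (mem_set (meridian_sphere t)).

Lemma unit_clamp_continuous : continuous unit_clamp.
Proof.
move=> t; apply: (@continuous_max R R (fun=> 0) (fun t => Num.min 1 t) t).
  exact: cst_continuous.
apply: (@continuous_min R R (fun=> 1) id t); first exact: cst_continuous.
by move=> A.
Qed.

Lemma meridian_continuous : continuous meridian.
Proof.
have lin_c : continuous (fun t : R => 1 - unit_clamp t *+ 2).
  move=> t; apply: cvgB; first exact: cvg_cst.
  by apply: cvgMn; exact: unit_clamp_continuous.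
apply: set_type_continuous => t;
  apply: (@cvg_row R _ (nbhs t) (nbhs_filter t)) => j.
rewrite mxE; under [X in X @ _ --> _]eq_fun do rewrite mxE.
case: ifP => _; first exact: lin_c.
case: ifP => _; last exact: cvg_cst.
apply: (@continuous_comp _ _ _
  (fun t : R => 1 - (1 - unit_clamp t *+ 2) ^+ 2) Num.sqrt).
  apply: cvgB; first exact: cvg_cst.
  by apply: cvgM; exact: lin_c.
exact: sqrt_continuous.
Qed.

Lemma meridian_antipode : meridian 1 = antipode (meridian 0).
Proof.
apply: val_inj; apply/rowP => j; rewrite !mxE !unit_clamp_id ?lexx ?ler01 //.
have e1 : 1 - 1 *+ 2 = -1 :> R by ring.
rewrite mul0rn subr0 e1 sqrrN expr1n subrr sqrtr0.
by do 2 case: ifP => _ //; rewrite oppr0.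
Qed.

End Meridian.

Section Coindex.
Variables (R : realType) (V : finType) (K : simplicial_complex V) (d : nat).
Local Notation Y := (AEmb1 R K d).

(** The meridian joins a point of the sphere to its antipode; by equivariance its image is a path
    from [f] to the reflection of [f]. *)
Lemma equivariant_homotopic m (phi : sphere R m.+2 -> Y) :
    equivariant_map phi ->
  exists f : realization R K -> 'rV[R]_d, almost_embedding f /\
    almost_embedding_homotopic f (@reflection R d \o f).
Proof.
move=> [phic phiN].
pose G (t : R) : {compact-open, realization R K -> 'rV[R]_d} :=
  val (phi (meridian m t) : @AEmb_set R V K d).
have GE t : almost_embedding (G t) :=
  set_mem (valP (phi (meridian m t) : @AEmb_set R V K d)).
have Gc : continuous G.
  move=> t; apply: (@continuous_comp _ _ _ (phi \o meridian m) val).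
    by apply: continuous_comp; [exact: meridian_continuous|exact: phic].
  exact: val_continuous.
exists (G 0); split; first exact: GE.
exists (uncurry G); split => //.
- apply: continuous_subspaceT; apply: continuous_uncurry => //.
  + exact: realization_locally_compact.
  + exact: realization_hausdorff.
  + by move=> t; have [] := GE t.
- by move=> x; rewrite /= /G meridian_antipode phiN.
- by move=> t _; exact: GE.
Qed.

Lemma sphere1_neq0 (x : sphere R 1) : (val x : 'rV[R]_1) 0 0 != 0.
Proof.
apply/eqP => x0; have := set_mem (valP x); rewrite /sphere_set /= big_ord1 x0.
by rewrite expr0n => /eqP; rewrite eq_sym oner_eq0.
Qed.

Lemma equivariant_map_sphere1 (y : Y) :
  exists phi : sphere R 1 -> Y, equivariant_map phi.
Proof.
exists (fun x => if 0 < (val x : 'rV[R]_1) 0 0 then y else Z2_gen y); split.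
  move=> x.
  have cc : {for x, continuous (fun x : sphere R 1 => (val x : 'rV[R]_1) 0 0)}.
    apply: (@coord_cvg _ _ (nbhs x) (nbhs_filter x)); exact: val_continuous.
  have [x0|x0] := ltP 0 ((val x : 'rV[R]_1) 0 0).
    apply: (near_cst_continuous y); near=> z.
    rewrite (_ : 0 < _ = true) //; near: z; exact: (cvgr_gt _ cc _ x0).
  have x0' : (val x : 'rV[R]_1) 0 0 < 0 by rewrite lt_neqAle sphere1_neq0.
  apply: (near_cst_continuous (Z2_gen y)); near=> z.
  rewrite (_ : 0 < _ = false) //; apply/negbTE; rewrite -leNgt; apply: ltW.
  by near: z; exact: (cvgr_lt _ cc _ x0').
move=> x; rewrite /= mxE oppr_gt0.
have := sphere1_neq0 x; case: ltgtP => //= _ _.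
by rewrite AEmb_reflectK.
Unshelve. all: by end_near. Qed.

Lemma AEmb1_coindex0 (f : realization R K -> 'rV[R]_d) : almost_embedding f ->
  (forall f g : realization R K -> 'rV[R]_d,
     almost_embedding f -> mirror_image f g ->
       ~ almost_embedding_homotopic f g) ->
  is_coindex R Y 0.
Proof.
move=> fE no_mirror; split.
  exists 1%N; split => //.
  apply: equivariant_map_sphere1.
  exact: (exist (fun g => g \in @AEmb_set R V K d) f (mem_set fE)).
(* The cases [n = 0] and [n = 1] are the spheres of dimension -1 and 0, which satisfy the bound. *)
move=> _ [[|[|m]] [-> [phi phiE]]] //.
have [g [gE gH]] := equivariant_homotopic phiE.
by have := no_mirror _ _ gE (mirror_image_reflection g).
Qed.

End Coindex.

(** * Application to the two complexes *)

Definition vertex_realization (R : realType) (V : finType)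
    (K : simplicial_complex V)
    (v : V) (vK : [set v]%SET \in faces K) : realization R K.
Proof.
apply: (@exist {ptws V -> R} (fun x => x \in @realization_set R V K)
  (fun u => (u == v)%:R)).
apply: mem_set; split.
- by move=> u; rewrite ler0n.
- by rewrite (bigD1 v) //= eqxx big1 ?addr0 // => u /negPf ->.
by exists [set v]%SET => // u; rewrite inE => /negPf ->.
Defined.

Lemma chart_no_mirror_coindex0 (R : realType) (V : finType)
    (K : simplicial_complex V) (d : nat)
    (v : V) : [set v]%SET \in faces K -> deleted_join_chart R K d.+2 ->
  (forall s t : {set V}, s \in faces K -> t \in faces K ->
     [disjoint s & t]%B -> (#|s| + #|t| <= d.+2)%N) ->
  (forall f g : realization R K -> 'rV[R]_d.+1,
     almost_embedding f -> mirror_image f g ->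
       ~ almost_embedding_homotopic f g) /\
  is_coindex R (AEmb1 R K d.+1) 0.
Proof.
move=> vK psi K_general.
have no_mirror := not_homotopic_mirror_image psi (vertex_realization R vK).
split; first exact: no_mirror.
exact: (AEmb1_coindex0 (moment_map_almost_embedding R K_general) no_mirror).
Qed.

Local Close Scope ring_scope.
Local Close Scope classical_set_scope.

Theorem corollary1p3 (R : realType) (k : nat) :
  let Delta := skeleton k (simplex (2 * k + 2)) in
  let J := join_power (points 3) k.+1 in
  let d := (2 * k).+1 in
  [/\ forall f g : realization R Delta -> 'rV[R]_d,
        almost_embedding f -> mirror_image f g ->
        ~ almost_embedding_homotopic f g,
      forall f g : realization R J -> 'rV[R]_d,
        almost_embedding f -> mirror_image f g ->
        ~ almost_embedding_homotopic f g,
      is_coindex R (AEmb1 R Delta d) 0%R &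
      is_coindex R (AEmb1 R J d) 0%R].
Proof.
move=> Delta J d.
have two_faces a b : (a <= k.+1 -> b <= k.+1 -> a + b <= (2 * k).+2)%N by lia.
have [||noD coD] := chart_no_mirror_coindex0 (v := ord0) _ (skeleton_chart R k).
- by rewrite !inE cards1.
- by move=> s t; rewrite !inE /= => sk tk _; exact: two_faces.
(* At most one vertex in each of the [k.+1] blocks: the projection to the blocks is injective on a
   face. *)
have J_card s : s \in faces J -> (#|s| <= k.+1)%N.
  rewrite inE => /forallP sJ; rewrite -[leqRHS]card_ord.
  rewrite -(card_in_imset (f := fst)); first exact: max_card.
  move=> [i a] [j b] sa sb /= ij; rewrite -ij in sb *.
  have /card_le1_eqP ab : (#|[set v | (i, v) \in s]%SET| <= 1)%N.
    by have := sJ i; rewrite inE.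
  by congr (_, _); apply: ab; rewrite inE.
have [||noJ coJ] := chart_no_mirror_coindex0 (v := (ord0, ord0)) _
  (join_chart R k).
- rewrite inE; apply/forallP => i; rewrite inE.
  apply: (@leq_trans #|[set (ord0 : 'I_3)]%SET|); last by rewrite cards1.
  apply/subset_leq_card/fintype.subsetP => a.
  by rewrite !inE xpair_eqE => /andP[].
- by move=> s t /J_card sk /J_card tk _; exact: two_faces.
by split.
Qed.
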